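(* Let $K=[a,b]$ be a closed interval with $a,b\in\mathbb Z$ and $a<b$, and let $\alpha$ be an algebraic number such that $\mathcal O(\alpha)\subset\mathbb R\setminus[a,b]$. Let $t\in[0,1]$ and $$\mu_t:=\mu_t(\alpha,K)=t\,\nu_K+\frac{1-t}{\deg\alpha}\sum_{\gamma\in\mathcal O(\alpha)}\omega(\gamma,K).$$ Then $\int\log|Q(z)|\,d\mu_t(z)\ge0$ for all $Q\in\mathbb Z[z]\setminus\{0\}$ if and only if $$\int\log|z-a|\,d\mu_t(z)\ge0\quad\text{and}\quad\int\log|z-b|\,d\mu_t(z)\ge0.$$
   Context: Algebraic notation. For an algebraic number $\alpha$, $\deg\alpha$ is the degree of its minimal polynomial over $\mathbb Q$ and $\mathcal O(\alpha)\subset\mathbb C$ is the set of roots of this minimal polynomial (the Galois conjugates of $\alpha$). Potential theory. $\mathcal P(K)$ is the set of Borel probability measures with support contained in the compact set $K$. For a finite compactly supported Borel measure $\mu$, $I(\mu)=\iint\log\frac1{|z-w|}\,d\mu(z)\,d\mu(w)$. The logarithmic capacity of a compact set $K$ is $c(K)=\exp(-\inf_{\mu\in\mathcal P(K)}I(\mu))$; for a general set $E$, $c(E)$ is the supremum of $c(K')$ over compact $K'\subset E$. If $c(K)>0$, the equilibrium measure $\nu_K$ is the unique minimizer of $I$ over $\mathcal P(K)$. ''Quasi-everywhere'' means except on a set of logarithmic capacity zero. For a domain $\Omega\subset\widehat{\mathbb C}$ with $c(\partial\Omega)>0$ and $y\in\Omega$, the harmonic measure $\omega(y,\Omega)$ is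 the unique Borel probability measure on $\partial\Omega$ with $u(y)=\int f\,d\omega(y,\Omega)$ for every continuous $f$ on $\partial\Omega$, where $u$ is the (bounded) harmonic function on $\Omega$ whose boundary values agree with $f$ quasi-everywhere on $\partial\Omega$. For $y\notin K$, $\omega(y,K):=\omega(y,\Omega)$, where $\Omega$ is the connected component of $\widehat{\mathbb C}\setminus K$ containing $y$; it is regarded as a measure on $K$. For $K=[a,b]$ these are explicit: $d\nu_K(x)=\frac{dx}{\pi\sqrt{(x-a)(b-x)}}$ and, for real $y\notin[a,b]$, $d\omega(y,K)(x)=\frac{\sqrt{|(y-a)(y-b)|}}{\pi|y-x|\sqrt{(x-a)(b-x)}}\,dx$, for $a<x<b$. *)

(* Defs.v *)
From HB Require Import structures.
From mathcomp Require Import all_boot all_order all_algebra.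
From mathcomp Require Import complex.
From mathcomp Require Import all_classical all_reals all_analysis.

Set Implicit Arguments.
Unset Strict Implicit.
Unset Printing Implicit Defensive.

Import Order.TTheory GRing.Theory Num.Theory.
Import numFieldNormedType.Exports.

Local Open Scope classical_set_scope.
Local Open Scope ring_scope.

(* The complex plane carries its Borel sigma-algebra, topology and real
   differential structure as [R * R]; its field structure is that of [R[i]]. *)
Notation plane R := (R * R)%type.

Section plane.
Context {R : realType}.

Definition toC (z : plane R) : R[i] := Complex z.1 z.2.

Definition ofC (w : R[i]) : plane R := (complex.Re w, complex.Im w).

(* [`|w|] is a real element of [R[i]]; note that [lne 0 = -oo]. *)
Definition logabs (w : R[i]) : \bar R := lne (complex.Re `|w|)%:E.

Definition segment (a b : R) : set (plane R) :=
  [set z | a <= z.1 <= b /\ z.2 = 0].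

End plane.

Section capacity.
Context {R : realType}.

(* The inner integrand takes the value +oo on the diagonal. *)
Definition energy (mu : {measure set (plane R) -> \bar R}) : \bar R :=
  (\int[mu]_z \int[mu]_w - logabs (toC z - toC w)%R)%E.

(* A probability measure has its support in a closed set exactly when it
   gives mass 0 to the complement. *)
Definition supported (K : set (plane R)) (mu : probability (plane R) R) : Prop :=
  mu (~` K) = 0%E.

Definition capacity_compact (K : set (plane R)) : \bar R :=
  expeR (- ereal_inf [set energy mu | mu in supported K])%E.

Definition capacity (E : set (plane R)) : \bar R :=
  ereal_sup [set capacity_compact K | K in [set K | compact K /\ K `<=` E]].

(* For a compact [K] of positive capacity exactly one measure qualifies. *)
Definition is_equilibrium_measure (K : set (plane R))
    (nu : probability (plane R) R) : Prop :=
  supported K nu /\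
  forall mu : probability (plane R) R,
    supported K mu -> (energy nu <= energy mu)%E.

End capacity.

(* The Riemann sphere: [Some z] is the finite point z and [None] is infinity. *)
Notation sphere R := (one_point_compactification (plane R)).

Section harmonic_measure.
Context {R : realType}.

(* The coordinate z |-> 1/z around infinity. *)
Definition chart_infty (z : plane R) : sphere R :=
  if z == 0 then None else Some (ofC (toC z)^-1).

Definition coord_vectors : set (plane R) := [set (1, 0); (0, 1)].

(* [u] is of class C^2 with zero Laplacian on [U], meant for open [U]. *)
Definition harmonic_on (U : set (plane R)) (u : plane R -> R) : Prop :=
  forall z, U z ->
    (forall v w, coord_vectors v -> coord_vectors w ->
      [/\ derivable u z v,
          derivable ('D_v u) z w &
          {for z, continuous ('D_w ('D_v u))}]) /\
    'D_(1, 0) ('D_(1, 0) u) z + 'D_(0, 1) ('D_(0, 1) u) z = 0.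

Definition sphere_harmonic_on (Omega : set (sphere R)) (u : sphere R -> R) : Prop :=
  harmonic_on (Some @^-1` Omega) (u \o Some) /\
  harmonic_on (chart_infty @^-1` Omega) (u \o chart_infty).

(* The finite part of the boundary of an open subset of the sphere. For a
   component of the complement of a compact subset of the plane this is the
   whole boundary. *)
Definition boundary (Omega : set (sphere R)) : set (plane R) :=
  Some @^-1` (closure Omega `\` Omega).

Definition has_boundary_value (Omega : set (sphere R)) (u : sphere R -> R)
    (zeta : plane R) (l : R) : Prop :=
  u (Some z) @[z --> within (Some @^-1` Omega) (nbhs zeta)] --> l.

Definition solves_dirichlet (Omega : set (sphere R)) (f : plane R -> R)
    (u : sphere R -> R) : Prop :=
  [/\ sphere_harmonic_on Omega u,
      (exists M : R, forall x, Omega x -> `|u x| <= M) &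
      capacity [set zeta | boundary Omega zeta /\
                           ~ has_boundary_value Omega u zeta (f zeta)] = 0%E].

(* [w] is the harmonic measure at [y] of [Omega], for a domain [Omega] whose
   boundary lies in the plane and has positive capacity; the solution [u] is
   then unique for each [f], and so is [w]. *)
Definition is_harmonic_measure (y : sphere R) (Omega : set (sphere R))
    (w : probability (plane R) R) : Prop :=
  supported (boundary Omega) w /\
  forall (f : plane R -> R) (u : sphere R -> R),
    {within boundary Omega, continuous f} ->
    solves_dirichlet Omega f u ->
    (\int[w]_(x in boundary Omega) (f x)%:E = (u y)%:E)%E.

Definition component (y : plane R) (K : set (plane R)) : set (sphere R) :=
  connected_component (~` (Some @` K) : set (sphere R)) (Some y).

Definition is_harmonic_measure_compact (y : plane R) (K : set (plane R))
    (w : probability (plane R) R) : Prop :=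
  is_harmonic_measure (Some y) (component y K) w.

End harmonic_measure.

Section algebraic_numbers.
Context {R : realType}.

Definition algebraic (alpha : R[i]) : Prop := algebraicOver (@ratr R[i]) alpha.

Definition is_minimal_poly (alpha : R[i]) (p : {poly rat}) : Prop :=
  [/\ p \is monic, root (map_poly ratr p) alpha &
      forall q : {poly rat}, q != 0 -> root (map_poly ratr q) alpha ->
        (size p <= size q)%N].

Definition minimal_poly (alpha : R[i]) : {poly rat} :=
  xget 0 [set p | is_minimal_poly alpha p].

Definition degree (alpha : R[i]) : nat := (size (minimal_poly alpha)).-1.

Definition conjugates (alpha : R[i]) : seq R[i] :=
  undup (sval (closed_field_poly_normal
                 (map_poly ratr (minimal_poly alpha) : {poly R[i]}))).

End algebraic_numbers.

Section mu_t.
Context {R : realType}.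
Variables (t : {i01 R}) (alpha : R[i]) (nu : probability (plane R) R)
  (omega : R[i] -> probability (plane R) R).

Definition mu_t : {measure set (plane R) -> \bar R} :=
  measure_add
    (mscale (t%:num)%:nng nu)
    (mscale ((1 - t%:num) / (degree alpha)%:R)%:nng
      (msum (fun k => omega (conjugates alpha)`_k : {measure set _ -> \bar R})
            (size (conjugates alpha)))).

End mu_t.

(* Main.v *)
Require Import Defs.
From HB Require Import structures.
From mathcomp Require Import all_boot all_order all_algebra.
From mathcomp Require Import complex.
From mathcomp Require Import all_classical all_reals all_analysis.
From mathcomp Require Import measurable_realfun ring lra.

(** The leading coefficient of a nonzero integer polynomial [Q] has modulus at
least 1 and its roots split [log |Q|] into functions [log |z - r|], so it is
enough that the logarithmic potential [U(r)] of [mu_t], the integral of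
[log |z - r|], is nonnegative at every complex [r].  As [mu_t] lives on
[K = [a, b]], moving [r] to the nearest point of [K] brings it closer to every
point of [K] and can only decrease [U]; so only [r] in [K] matters.  There, [U] is
a constant plus a nonnegative combination of the concave functions
[log |r - gamma|] with [gamma] real outside [K]; a concave function that is
nonnegative at both endpoints of [K] is nonnegative on [K]
([potential_criterion]).

The work is to compute [U] from the definitions of the equilibrium measure and
of harmonic measure.  Write [X] for the affine coordinate that maps [K] onto
[[-1, 1]], and [T_n] for the Chebyshev polynomials.  Both measures have geometric
Chebyshev moments: the integral of [T_n(X)] is [s ^ n] with [|s| < 1], where
[s = 0] for the equilibrium measure.  The expansion

  [- log (2 |x - y|) = sum_(n >= 1) (2 / n) T_n(x) T_n(y)]

turns these moments into the potential
[log ((b - a) / 2) - log 2 + log (1 - 2 s x + s ^ 2)], the logarithm of an affine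
function ([log_potential]).  The series does not converge absolutely and is handled
by Abel summation: the factor [r ^ n] with [r < 1] gives a kernel in closed form
([log_kernel_expansion]) that increases to [- log |x - y|] as [r] tends to 1.

- Equilibrium measure ([equilibrium_moments]): by the same expansion the energy of
  a measure with moments [c_n] is at least that of a measure with all moments zero,
  plus [sum (2 / n) c_n ^ 2]; the arcsine law is a competitor with all moments zero,
  so a minimiser has [c_n = 0] for [n >= 1].

- Harmonic measure ([harmonic_measure_real_moments]): the inverse of the Joukowski map
  [w |-> (w + 1 / w) / 2] sends the complement of [K] in the sphere into the unit disc.
  If [zeta] denotes it, [Re (zeta ^ n)] is the bounded harmonic function with boundary
  values [T_n(X)] ([chebT_solves_dirichlet]), so the [n]-th moment of the harmonic
  measure at [y] is [Re (zeta(y) ^ n)], and [zeta(y)] is real for [y] real.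

Harmonicity is obtained from complex differentiability: [smooth k] is a class of
functions closed under sums, products, inverses and square roots, and the real part
of a member of [smooth 2] is harmonic ([smooth_harmonic]). *)

Set Implicit Arguments.
Unset Strict Implicit.
Unset Printing Implicit Defensive.

Import Order.TTheory GRing.Theory Num.Theory.
Import numFieldNormedType.Exports.

Local Open Scope classical_set_scope.
Local Open Scope ring_scope.

(** * Chebyshev polynomials and the logarithmic kernel *)

Fixpoint chebT {A : comNzRingType} (n : nat) (x : A) : A :=
  match n with
  | 0 => 1
  | n'.+1 => match n' with
            | 0 => x
            | n''.+1 => 2 * x * chebT n' x - chebT n'' x
            end
  end.

Arguments chebT : simpl never.

Lemma chebT0 {A : comNzRingType} (x : A) : chebT 0 x = 1.
Proof. by []. Qed.

Lemma chebT1 {A : comNzRingType} (x : A) : chebT 1 x = x.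
Proof. by []. Qed.

Lemma chebTSS {A : comNzRingType} n (x : A) :
  chebT n.+2 x = 2 * x * chebT n.+1 x - chebT n x.
Proof. by []. Qed.

Section chebT_real.
Context {R : realType}.
Implicit Types (x y c r : R) (n N : nat).

Lemma chebT_cos n (t : R) : chebT n (cos t) = cos (n%:R * t).
Proof.
suff: chebT n (cos t) = cos (n%:R * t) /\
      chebT n.+1 (cos t) = cos (n.+1%:R * t) by case.
elim: n => [|n [IH0 IH1]]; first by rewrite mul0r cos0 mul1r.
split=> //; rewrite chebTSS IH0 IH1.
have -> : n.+2%:R * t = n.+1%:R * t + t by rewrite -(natr1 n.+1); ring.
have -> : n%:R * t = n.+1%:R * t - t by rewrite -(natr1 n); ring.
by rewrite cosB cosD; ring.
Qed.

Lemma cos_surj x : -1 <= x <= 1 -> exists t : R, x = cos t.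
Proof. by move=> hx; exists (acos x); rewrite acosK// in_itv. Qed.

Lemma chebT_norm_le1 n x : -1 <= x <= 1 -> `|chebT n x| <= 1.
Proof.
by move=> /cos_surj[t ->]; rewrite chebT_cos ler_norml cos_geN1 cos_le1.
Qed.

Lemma chebT_product n (s t : R) :
  chebT n (cos (s + t)) + chebT n (cos (s - t)) =
  2 * chebT n (cos s) * chebT n (cos t).
Proof. by rewrite !chebT_cos mulrDr mulrBr cosB cosD; ring. Qed.

(** The generating function of the [chebT n.+1 c], cut at order [N]; the last two
terms on the right are what the cut leaves over. *)
Lemma chebT_geometric_sum N r c :
  (1 - 2 * r * c + r ^+ 2) * (\sum_(i < N) r ^+ i * chebT i.+1 c) =
  c - r - r ^+ N * chebT N.+1 c + r ^+ N.+1 * chebT N c.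
Proof.
elim: N => [|N IH]; first by rewrite big_ord0 chebT0 chebT1; ring.
by rewrite big_ord_recr/= mulrDr IH chebTSS !exprS; ring.
Qed.

Lemma quadratic_ge r c : -1 <= c <= 1 ->
  (1 - `|r|) ^+ 2 <= 1 - 2 * r * c + r ^+ 2.
Proof.
move=> /andP[c1 c2].
have h : r * c <= `|r|.
  rewrite (le_trans (ler_norm _))// normrM ler_piMr// ler_norml.
  by rewrite c1 c2.
have -> : r ^+ 2 = `|r| ^+ 2 by rewrite real_normK ?num_real.
by lra.
Qed.

Lemma quadratic_gt0 r c : -1 <= c <= 1 -> `|r| < 1 ->
  0 < 1 - 2 * r * c + r ^+ 2.
Proof.
move=> hc hr; apply: lt_le_trans (quadratic_ge r hc).
by rewrite exprn_gt0// subr_gt0.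
Qed.

(** The remainder after [N] terms of the expansion
[ln (1 - 2 r c + r^2) / 2 = - sum_(n >= 1) (r^n / n) T_n(c)]. *)
Definition log_partial N c (r : R) :=
  ln (1 - 2 * r * c + r ^+ 2) / 2 +
  \sum_(i < N) r ^+ i.+1 / i.+1%:R * chebT i.+1 c.

(** Differentiation in [r] turns the sum into a geometric one, so that only the two
boundary terms of [chebT_geometric_sum] survive. *)
Lemma is_derive_log_partial N c r : -1 <= c <= 1 -> `|r| < 1 ->
  is_derive r 1 (log_partial N c)
    (r ^+ N * (r * chebT N c - chebT N.+1 c) / (1 - 2 * r * c + r ^+ 2)).
Proof.
move=> hc hr; have q0 := quadratic_gt0 hc hr.
have hln : is_derive r 1 (fun r : R => ln (1 - 2 * r * c + r ^+ 2) / 2)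
   ((r - c) / (1 - 2 * r * c + r ^+ 2)).
  have d1 : is_derive r 1 (fun r : R => 1 - 2 * r * c + r ^+ 2) (2 * (r - c)).
    apply: is_derive_eq; rewrite /GRing.scale/=; ring.
  have := @is_derive1_comp _ (@ln R) (fun r : R => 1 - 2 * r * c + r ^+ 2) r _ _ (is_derive1_ln q0) d1.
  move=> /(@is_deriveZ _ _ _ _ (2^-1)) H.
  have -> : (fun r : R => ln (1 - 2 * r * c + r ^+ 2) / 2) =
    2^-1 \*: (@ln R \o (fun r : R => 1 - 2 * r * c + r ^+ 2)).
    by apply/funext => x /=; rewrite mulrC.
  apply: (is_derive_eq H).
  by rewrite /GRing.scale/=; field; rewrite gt_eqF.
have hs : is_derive r 1
   (fun r : R => \sum_(i < N) r ^+ i.+1 / i.+1%:R * chebT i.+1 c)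
   (\sum_(i < N) r ^+ i * chebT i.+1 c).
  have -> : (fun r : R => \sum_(i < N) r ^+ i.+1 / i.+1%:R * chebT i.+1 c) =
   \sum_(i < N) (fun r : R => r ^+ i.+1 / i.+1%:R * chebT i.+1 c).
    by apply/funext => x; rewrite fct_sumE.
  apply: is_derive_sum => i.
  have -> : (fun r : R => r ^+ i.+1 / i.+1%:R * chebT i.+1 c) =
      (i.+1%:R^-1 * chebT i.+1 c) \*: (id ^+ i.+1).
    by apply/funext => y /=; rewrite exprfctE /GRing.scale/= -mulrA [LHS]mulrC.
  have := is_deriveX i.+1 (is_derive_id r 1).
  move=> /(is_deriveZ (i.+1%:R^-1 * chebT i.+1 c)) H.
  apply: (is_derive_eq H); rewrite /GRing.scale/= mulr1.
  have : i.+1%:R != 0 :> R by rewrite pnatr_eq0.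
  by move: (i.+1%:R) => k k0; field.
have := is_deriveD hln hs => H; apply: (is_derive_eq H).
have := chebT_geometric_sum N r c.
set S := \sum_(i < N) _ => hS.
have -> : S = (c - r - r ^+ N * chebT N.+1 c + r ^+ N.+1 * chebT N c)
    / (1 - 2 * r * c + r ^+ 2).
  by rewrite -hS mulrC mulKf// gt_eqF.
by rewrite (exprS r N); field; rewrite gt_eqF.
Qed.

(** The remainder vanishes at [r = 0], and its derivative is small between [0] and [r]:
the mean value theorem bounds it without any theory of power series. *)
Lemma log_partial_bound N c r : -1 <= c <= 1 -> `|r| < 1 ->
  `|log_partial N c r| <= 2 * `|r| ^+ N / (1 - `|r|) ^+ 2.
Proof.
move=> hc hr.
have F0 : log_partial N c 0 = 0.
  rewrite /log_partial mulr0 mul0r subr0 expr0n/= addr0 ln1 mul0r add0r.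
  by rewrite big1// => i _; rewrite expr0n/= !mul0r.
pose dF x := x ^+ N * (x * chebT N c - chebT N.+1 c) /
   (1 - 2 * x * c + x ^+ 2).
have dFle x : `|x| <= `|r| -> `|dF x| <= 2 * `|r| ^+ N / (1 - `|r|) ^+ 2.
  move=> xr; have x1 : `|x| < 1 := le_lt_trans xr hr.
  have q0 := quadratic_gt0 hc x1; have q1 := quadratic_ge x hc.
  rewrite /dF 2!normrM; apply: ler_pM => //.
    rewrite mulrC; apply: ler_pM => //.
      rewrite (le_trans (ler_normB _ _))// (_ : 2 = 1 + 1)// lerD//.
        by rewrite normrM mulr_ile1// ?chebT_norm_le1// ltW.
      by rewrite chebT_norm_le1.
    by rewrite normrX lerXn2r// nnegrE.
  rewrite normfV (gtr0_norm q0) lef_pV2 ?posrE//.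
    apply: le_trans q1.
    by rewrite lerXn2r// ?nnegrE ?subr_ge0 ?(ltW hr) ?(ltW x1)// lerD2l lerN2.
  by rewrite exprn_gt0// subr_gt0.
have main y : `|y| <= `|r| -> is_derive y 1 (log_partial N c) (dF y).
  by move=> yr; apply: is_derive_log_partial => //; apply: le_lt_trans hr.
have cont (A : set R) : (forall y, A y -> `|y| <= `|r|) ->
    {within A, continuous (log_partial N c)}.
  move=> hA; apply: continuous_in_subspaceT => y /set_mem /hA /main d.
  by apply/differentiable_continuous/derivable1_diffP.
have fin y : `|y| <= `|r| -> `|dF y * r| <= 2 * `|r| ^+ N / (1 - `|r|) ^+ 2.
  by move=> yr; rewrite normrM (le_trans _ (dFle _ yr))// ler_piMr// ltW.
have [r0|r0|r0] := ltgtP r 0.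
- have A1 : forall y, y \in `[r, 0] -> `|y| <= `|r|.
    move=> y; rewrite in_itv/= => /andP[y1 y2].
    by rewrite ler0_norm// (ltr0_norm r0) lerN2.
  have [||y hy] := @MVT R (log_partial N c) dF r 0 r0.
  + by move=> y /subset_itv_oo_cc /A1; apply: main.
  + by apply: cont => y; apply: A1.
  rewrite F0 !sub0r => /eqP; rewrite mulrN eqr_opp => /eqP ->.
  by apply: fin; apply: A1; exact: subset_itv_oo_cc.
- have A1 : forall y, y \in `[0, r] -> `|y| <= `|r|.
    move=> y; rewrite in_itv/= => /andP[y1 y2].
    by rewrite ger0_norm// (gtr0_norm r0).
  have [||y hy] := @MVT R (log_partial N c) dF 0 r r0.
  + by move=> y /subset_itv_oo_cc /A1; apply: main.
  + by apply: cont => y; apply: A1.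
  rewrite F0 !subr0 => ->.
  by apply: fin; apply: A1; exact: subset_itv_oo_cc.
- by rewrite r0 F0 normr0 mulr_ge0 ?invr_ge0 ?sqr_ge0 ?mulr_ge0 ?exprn_ge0.
Qed.

End chebT_real.

Section kernel.
Context {R : realType}.
Implicit Types (x y r s : R) (n N : nat).

Definition joukowski r : R := (r + r^-1) / 2.

(** Abel's regularisation of [- ln |x - y|]: at [joukowski r = 1], that is in the limit
where [r] tends to 1, the argument of the logarithm is [(x - y) ^ 2]. *)
Definition log_kernel r x y : R :=
  - ln ((joukowski r - x * y) ^+ 2 - (1 - x ^+ 2) * (1 - y ^+ 2)) / 2.

(** With [x = cos a] and [y = cos b], the kernel is, up to the constant [ln (2 r)], the
sum of two copies of [- ln (1 - 2 r c + r^2) / 2], at [c = cos (a + b)] and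
[c = cos (a - b)]. *)
Lemma kernel_quadratics r (a b : R) : 0 < r ->
  (1 - 2 * r * cos (a + b) + r ^+ 2) * (1 - 2 * r * cos (a - b) + r ^+ 2) =
  (2 * r) ^+ 2 * ((joukowski r - cos a * cos b) ^+ 2 -
                  (1 - cos a ^+ 2) * (1 - cos b ^+ 2)).
Proof.
move=> r0; rewrite cosB cosD -!sin2cos2 /joukowski.
by field; rewrite gt_eqF.
Qed.

Definition kernel_partial N r x y : R :=
  \sum_(i < N) 2 * r ^+ i.+1 / i.+1%:R * chebT i.+1 x * chebT i.+1 y.

(** The product formula [T_n(cos (a + b)) + T_n(cos (a - b)) = 2 T_n(cos a) T_n(cos b)]
separates the variables in the two expansions given by [kernel_quadratics]. *)
Lemma log_kernel_expansion N r x y :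
  0 < r < 1 -> -1 <= x <= 1 -> -1 <= y <= 1 ->
  `|log_kernel r x y - ln (2 * r) - kernel_partial N r x y| <=
  4 * r ^+ N / (1 - r) ^+ 2.
Proof.
move=> /andP[r0 r1] /cos_surj[a ->] /cos_surj[b ->].
have c1 (t : R) : -1 <= cos t <= 1 by rewrite cos_geN1 cos_le1.
have r1' : `|r| < 1 by rewrite gtr0_norm.
have p0 := quadratic_gt0 (c1 (a + b)) r1'.
have m0 := quadratic_gt0 (c1 (a - b)) r1'.
have Bp := log_partial_bound N (c1 (a + b)) r1'.
have Bm := log_partial_bound N (c1 (a - b)) r1'.
have -> : log_kernel r (cos a) (cos b) - ln (2 * r) -
    kernel_partial N r (cos a) (cos b) =
    - (log_partial N (cos (a + b)) r + log_partial N (cos (a - b)) r).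
  have Q0 : 0 < (joukowski r - cos a * cos b) ^+ 2 -
                  (1 - cos a ^+ 2) * (1 - cos b ^+ 2).
    have := mulr_gt0 p0 m0; rewrite kernel_quadratics// pmulr_rgt0//.
    by rewrite exprn_gt0// mulr_gt0.
  have : ln (1 - 2 * r * cos (a + b) + r ^+ 2) +
         ln (1 - 2 * r * cos (a - b) + r ^+ 2) =
    2 * ln (2 * r) + ln ((joukowski r - cos a * cos b) ^+ 2 -
                  (1 - cos a ^+ 2) * (1 - cos b ^+ 2)).
    rewrite -lnM ?posrE// kernel_quadratics// lnM ?posrE//; last first.
      by rewrite exprn_gt0// mulr_gt0.
    by rewrite lnXn ?mulr_gt0// !mulr_natl.
  rewrite /log_kernel /log_partial => hl.
  have -> : kernel_partial N r (cos a) (cos b) =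
     \sum_(i < N) r ^+ i.+1 / i.+1%:R * chebT i.+1 (cos (a + b)) +
     \sum_(i < N) r ^+ i.+1 / i.+1%:R * chebT i.+1 (cos (a - b)).
    rewrite -big_split; apply: eq_bigr => i _ /=.
    by rewrite -mulrDr chebT_product; ring.
  move: hl; set A := \sum_(i < N) _; set B := \sum_(i < N) _; lra.
rewrite normrN (le_trans (ler_normD _ _))//.
rewrite (gtr0_norm r0) in Bp Bm.
rewrite (_ : 4 * r ^+ N / _ = 2 * r ^+ N / (1 - r) ^+ 2 + 2 * r ^+ N / (1 - r) ^+ 2).
  exact: lerD.
by rewrite -!mulrA -mulrDl; congr (_ * _); ring.
Qed.

Lemma kernel_error_cvg0 r : 0 < r < 1 ->
  4 * r ^+ N / (1 - r) ^+ 2 @[N --> \oo] --> (0 : R).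
Proof.
move=> /andP[r0 r1].
have -> : (fun N => 4 * r ^+ N / (1 - r) ^+ 2) =
   (fun N => (4 / (1 - r) ^+ 2) * r ^+ N).
  by apply/funext => N; rewrite mulrAC.
rewrite -[X in _ --> X](mulr0 (4 / (1 - r) ^+ 2)).
by apply: cvgM; [exact: cvg_cst|apply: cvg_expr; rewrite gtr0_norm].
Qed.

Lemma joukowski_gt1 r : 0 < r < 1 -> 1 < joukowski r.
Proof.
move=> /andP[r0 r1]; rewrite /joukowski -subr_gt0.
have -> : (r + r^-1) / 2 - 1 = (1 - r) ^+ 2 / (2 * r).
  by field; rewrite gt_eqF.
by rewrite divr_gt0 ?mulr_gt0 ?exprn_gt0 ?subr_gt0.
Qed.

Lemma joukowski_anti r s : 0 < r -> r <= s -> s < 1 ->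
  joukowski s <= joukowski r.
Proof.
move=> r0 rs s1; have s0 := lt_le_trans r0 rs.
rewrite /joukowski -subr_ge0.
have -> : (r + r^-1) / 2 - (s + s^-1) / 2 = (s - r) * (1 - r * s) / (2 * r * s).
  by field; rewrite !gt_eqF.
have rs1 : r * s <= 1 by rewrite mulr_ile1 ?ltW// (le_lt_trans rs).
by rewrite divr_ge0 ?mulr_ge0 ?subr_ge0// ltW.
Qed.

Lemma joukowski_le2 r : 1 / 2 <= r -> r < 1 -> joukowski r <= 2.
Proof.
move=> r2 r1; apply: le_trans (@joukowski_anti (1/2) r _ r2 r1) _ => //.
by rewrite /joukowski; lra.
Qed.

(** For [c >= 1] the difference of the two sides is [2 (c - 1) (1 - x y)]. *)
Lemma kernel_arg_ge (c x y : R) : 1 <= c -> -1 <= x <= 1 -> -1 <= y <= 1 ->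
  (c - 1) ^+ 2 + (x - y) ^+ 2 <= (c - x * y) ^+ 2 - (1 - x ^+ 2) * (1 - y ^+ 2).
Proof.
move=> c1 /andP[x1 x2] /andP[y1 y2].
have xy : x * y <= 1 by nra.
by rewrite -subr_ge0 [X in 0 <= X](_ : _ = 2 * (c - 1) * (1 - x * y)); [nra|ring].
Qed.

Lemma kernel_arg_gt0 r x y : 0 < r < 1 -> -1 <= x <= 1 -> -1 <= y <= 1 ->
  0 < (joukowski r - x * y) ^+ 2 - (1 - x ^+ 2) * (1 - y ^+ 2).
Proof.
move=> hr hx hy; have c1 := joukowski_gt1 hr.
apply: lt_le_trans (kernel_arg_ge (ltW c1) hx hy).
by rewrite ltr_pwDl ?sqr_ge0// exprn_gt0// subr_gt0.
Qed.

Lemma log_kernel_mono r s x y : 0 < r -> r <= s -> s < 1 ->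
  -1 <= x <= 1 -> -1 <= y <= 1 -> log_kernel r x y <= log_kernel s x y.
Proof.
move=> r0 rs s1 hx hy; have s0 := lt_le_trans r0 rs; have r1 := le_lt_trans rs s1.
have hr : 0 < r < 1 by rewrite r0.
have hs : 0 < s < 1 by rewrite s0.
rewrite /log_kernel ler_pM2r// lerN2 ler_ln ?posrE ?kernel_arg_gt0//.
rewrite lerD2r; have := joukowski_anti r0 rs s1.
have := joukowski_gt1 hs.
move: hx hy => /andP[x1 x2] /andP[y1 y2] c1 c2.
have xy : x * y <= 1 by nra.
by rewrite lerXn2r ?nnegrE ?lerD2r//; lra.
Qed.

(** A lower bound uniform in [r]: it is what makes monotone convergence applicable. *)
Lemma log_kernel_geN r x y : 1 / 2 <= r -> r < 1 ->
  -1 <= x <= 1 -> -1 <= y <= 1 -> - ln 3 <= log_kernel r x y.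
Proof.
move=> r2 r1 hx hy; have hr : 0 < r < 1 by rewrite r1 (lt_le_trans _ r2).
have c1 := joukowski_gt1 hr; have c2 := joukowski_le2 r2 r1.
have Q0 := kernel_arg_gt0 hr hx hy.
rewrite /log_kernel mulNr lerN2 ler_pdivrMr// mulr_natr -lnXn//.
rewrite ler_ln ?posrE ?exprn_gt0//.
move: hx hy => /andP[x1 x2] /andP[y1 y2].
have xy : -1 <= x * y by nra.
have : 0 <= (1 - x ^+ 2) * (1 - y ^+ 2) by apply: mulr_ge0; nra.
have : (joukowski r - x * y) ^+ 2 <= 3 ^+ 2.
  have : x * y <= 1 by nra.
  by move=> ?; rewrite lerXn2r ?nnegrE//; lra.
lra.
Qed.

Lemma log_kernel_le r x y : 0 < r < 1 -> -1 <= x <= 1 -> -1 <= y <= 1 ->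
  x != y -> log_kernel r x y <= - ln `|x - y|.
Proof.
move=> hr hx hy xy; have Q0 := kernel_arg_gt0 hr hx hy.
have xy0 : 0 < `|x - y| by rewrite normr_gt0 subr_eq0.
rewrite /log_kernel mulNr lerN2 ler_pdivlMr// mulr_natr -lnXn//.
rewrite ler_ln ?posrE ?exprn_gt0// real_normK ?num_real//.
apply: le_trans (kernel_arg_ge (ltW (joukowski_gt1 hr)) hx hy).
by rewrite lerDr sqr_ge0.
Qed.

End kernel.

(** * Potentials of measures with geometric Chebyshev moments *)

Section limits.
Context {R : realType}.

Lemma le0_of_le_cvg0 (a : R) (u : R ^nat) :
  u @ \oo --> (0 : R) -> (forall N, a <= u N) -> a <= 0.
Proof.
move=> u0 au; apply: (ler_cvg_to (cvg_cst a) u0).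
by apply: nearW => N; exact: au.
Qed.

End limits.

Section potential.
Context d (T : measurableType d) {R : realType}.
Variables (mu : {measure set T -> \bar R}) (D : set T) (X : T -> R).
Hypotheses (mD : measurable D) (muD : mu D = 1%E).
Implicit Types (r x s : R) (N n : nat).
Hypotheses (mX : measurable_fun D X) (X1 : forall z, D z -> -1 <= X z <= 1).

Lemma bounded_integrable (f : T -> R) (M : R) : measurable_fun D f ->
  (forall z, D z -> `|f z| <= M) -> mu.-integrable D (EFin \o f).
Proof.
move=> mf fM; apply: measurable_bounded_integrable => //.
  by rewrite muD ltry.
exists M; split; first exact: num_real.
by move=> y My z Dz; apply: le_trans (fM _ Dz) _; exact: ltW.
Qed.

Lemma measurable_chebT n : measurable_fun D (fun z => chebT n (X z)).
Proof.
suff: measurable_fun D (fun z => chebT n (X z)) /\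
      measurable_fun D (fun z => chebT n.+1 (X z)) by case.
elim: n => [|n [IH0 IH1]]; first by split; [exact: measurable_cst|].
split=> //; under eq_fun do rewrite chebTSS.
apply: measurable_funB => //; apply: measurable_funM => //.
by apply: measurable_funM => //; exact: measurable_cst.
Qed.

Lemma integrable_chebT n : mu.-integrable D (EFin \o (fun z => chebT n (X z))).
Proof.
apply: (@bounded_integrable _ 1); first exact: measurable_chebT.
by move=> z Dz; apply: chebT_norm_le1; exact: X1.
Qed.

(** The constant term is left out: all sums that occur start at degree 1. *)
Definition chebT_sum N (u : nat -> R) (y : R) : R :=
  \sum_(i < N) u i * chebT i.+1 y.

Lemma measurable_chebT_sum N u : measurable_fun D (fun z => chebT_sum N u (X z)).
Proof.
apply: measurable_sum => i; apply: measurable_funM; first exact: measurable_cst.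
exact: measurable_chebT.
Qed.

Lemma integrable_chebT_sum N u :
  mu.-integrable D (EFin \o (fun z => chebT_sum N u (X z))).
Proof.
elim: N => [|N IH].
  have -> : (fun z => chebT_sum 0 u (X z)) = cst 0.
    by apply/funext => z; rewrite /chebT_sum big_ord0.
  by apply: (@bounded_integrable _ 0) => // z _; rewrite normr0.
have -> : EFin \o (fun z => chebT_sum N.+1 u (X z)) =
   (EFin \o (fun z => chebT_sum N u (X z))) \+
   (fun z => (u N)%:E * (EFin \o (fun z => chebT N.+1 (X z))) z)%E.
  by apply/funext => z; rewrite /chebT_sum /= big_ord_recr.
by apply: integrableD => //; apply: integrableZl => //; exact: integrable_chebT.
Qed.

Lemma Rintegral_chebT_sum N u :
  \int[mu]_(z in D) chebT_sum N u (X z) =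
  \sum_(i < N) u i * \int[mu]_(z in D) chebT i.+1 (X z).
Proof.
elim: N => [|N IH].
  rewrite big_ord0 (_ : (fun z => _) = cst 0) ?Rintegral_cst ?mul0r//.
  by apply/funext => z; rewrite /chebT_sum big_ord0.
rewrite big_ord_recr /= -IH -RintegralZl//; last exact: integrable_chebT.
rewrite -RintegralD//.
- by apply: eq_Rintegral => z _; rewrite /chebT_sum big_ord_recr.
- exact: integrable_chebT_sum.
- by have := integrableZl mD (u N) (integrable_chebT N.+1).
Qed.

Lemma integral_shifted_chebT_sum N u (k : R) :
  (\int[mu]_(z in D) (k + chebT_sum N u (X z))%:E =
   (k + \sum_(i < N) u i * \int[mu]_(z in D) chebT i.+1 (X z))%:E)%E.
Proof.
have ik : mu.-integrable D (EFin \o cst k).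
  by apply: (@bounded_integrable _ `|k|).
have ip := integrable_chebT_sum N u.
rewrite -Rintegral_chebT_sum EFinD.
under eq_integral do rewrite EFinD.
rewrite (integralD mD ik ip)/=; congr (_ + _)%E.
  by rewrite integral_cst//= [X in (_ * X)%E]muD mule1.
by rewrite /Rintegral fineK//; exact: (integrable_fin_num mD ip).
Qed.

Lemma measurable_log_kernel r x :
  measurable_fun D (fun z => log_kernel r x (X z)).
Proof.
have m2 (f : T -> R) : measurable_fun D f -> measurable_fun D (fun z => f z ^+ 2).
  by move=> mf; exact: measurable_funX.
apply: measurable_funM; last exact: measurable_cst.
apply: measurable_funN.
apply: (@measurableT_comp _ _ _ _ _ _ (@ln R)) => //.
apply: measurable_funB.
  apply: m2; apply: measurable_funB; first exact: measurable_cst.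
  by apply: measurable_funM => //; exact: measurable_cst.
apply: measurable_funM; first exact: measurable_cst.
by apply: measurable_funB; [exact: measurable_cst|exact: m2].
Qed.

Lemma integrable_log_kernel r x : 0 < r < 1 -> -1 <= x <= 1 ->
  mu.-integrable D (EFin \o (fun z => log_kernel r x (X z))).
Proof.
move=> hr hx.
apply: (@bounded_integrable _ (4 * r ^+ 0 / (1 - r) ^+ 2 + `|ln (2 * r)|)).
  exact: measurable_log_kernel.
move=> z Dz; have := log_kernel_expansion 0 hr hx (X1 Dz).
rewrite /kernel_partial big_ord0 subr0 => h.
by rewrite -[X in `|X|](subrK (ln (2 * r))) (le_trans (ler_normD _ _))// lerD2r.
Qed.

Lemma Rintegral_log_kernel_bound N r x : 0 < r < 1 -> -1 <= x <= 1 ->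
  `|\int[mu]_(z in D) log_kernel r x (X z) - ln (2 * r) -
    \int[mu]_(z in D) kernel_partial N r x (X z)| <= 4 * r ^+ N / (1 - r) ^+ 2.
Proof.
move=> hr hx.
have ic (c : R) : mu.-integrable D (EFin \o cst c).
  by apply: (@bounded_integrable _ `|c|).
have cE (c : R) : \int[mu]_(z in D) c = c.
  by rewrite Rintegral_cst// muD mulr1.
have ik := integrable_log_kernel hr hx.
have ip := integrable_chebT_sum N (fun i => 2 * r ^+ i.+1 / i.+1%:R * chebT i.+1 x).
have i1 : mu.-integrable D (EFin \o (fun z => log_kernel r x (X z) - ln (2 * r))).
  by have := integrableB mD ik (ic (ln (2 * r))).
have i2 : mu.-integrable D (EFin \o (fun z => log_kernel r x (X z) - ln (2 * r)
    - kernel_partial N r x (X z))).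
  by have := integrableB mD i1 ip.
have -> : \int[mu]_(z in D) log_kernel r x (X z) - ln (2 * r) -
    \int[mu]_(z in D) kernel_partial N r x (X z) =
  \int[mu]_(z in D) (log_kernel r x (X z) - ln (2 * r)
    - kernel_partial N r x (X z)).
  by rewrite RintegralB// RintegralB ?cE//; exact: ic.
apply: le_trans (le_normr_Rintegral mD i2) _.
rewrite -[leRHS]cE; apply: le_Rintegral => //.
- exact: integrable_norm.
- exact: ic.
- by move=> z Dz; apply: log_kernel_expansion => //; exact: X1.
Qed.

(** Integrals against the Poisson-type density with parameter [s] have this form;
[s = 0] is the arcsine law. *)
Definition chebyshev_moments (s : R) :=
  forall n, \int[mu]_(z in D) chebT n (X z) = s ^+ n.

(** Integrating the expansion of [log_kernel_expansion] term by term against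
moments [s ^ n] gives the expansion of [log_partial_bound] at [r s]; the errors of both
tend to 0 with [N]. *)
Lemma Rintegral_log_kernel s r x : `|s| < 1 -> chebyshev_moments s ->
  0 < r < 1 -> -1 <= x <= 1 ->
  \int[mu]_(z in D) log_kernel r x (X z) =
  ln (2 * r) - ln (1 - 2 * (r * s) * x + (r * s) ^+ 2).
Proof.
move=> s1 ms hr hx; have /andP[r0 r1] := hr.
have rsr : `|r * s| <= r.
  by rewrite normrM (gtr0_norm r0) ler_piMr ?ltW.
have rs1 := le_lt_trans rsr r1.
apply/eqP; rewrite -subr_eq0 -normr_le0.
have := kernel_error_cvg0 hr => /(@cvgM _ _ _ _ _ _ _ _ (cvg_cst (2 : R))).
rewrite mulr0; move/le0_of_le_cvg0; apply => N /=.
have := Rintegral_log_kernel_bound N hr hx.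
have : `|log_partial N x (r * s)| <= 2 * r ^+ N / (1 - r) ^+ 2.
  apply: le_trans (log_partial_bound N hx rs1) _.
  apply: ler_pM; rewrite ?mulr_ge0 ?invr_ge0 ?sqr_ge0 ?exprn_ge0//.
    by rewrite ler_pM2l// lerXn2r// ?nnegrE// ltW.
  rewrite lef_pV2 ?posrE ?exprn_gt0 ?subr_gt0//.
  by rewrite lerXn2r ?nnegrE ?subr_ge0 ?(ltW rs1) ?(ltW r1)// lerD2l lerN2.
have -> : 4 * r ^+ N / (1 - r) ^+ 2 = 2 * (2 * r ^+ N / (1 - r) ^+ 2).
  by rewrite !mulrA -natrM.
rewrite (Rintegral_chebT_sum N (fun i => 2 * r ^+ i.+1 / i.+1%:R * chebT i.+1 x)).
have -> : \sum_(i < N) 2 * r ^+ i.+1 / i.+1%:R * chebT i.+1 x *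
    \int[mu]_(z in D) chebT i.+1 (X z) =
   2 * \sum_(i < N) (r * s) ^+ i.+1 / i.+1%:R * chebT i.+1 x.
  rewrite mulr_sumr; apply: eq_bigr => i _; rewrite ms exprMn; ring.
rewrite /log_partial; set S := \sum_(i < N) _; set J := \int[mu]_(z in D) _.
set e := 2 * r ^+ N / (1 - r) ^+ 2; set l := ln (1 - _ + _).
rewrite !ler_norml => /andP[h1 h2] /andP[h3 h4]; apply/andP; split; lra.
Qed.

End potential.

Section approach.
Context {R : realType}.

(** Starts at [1 / 2], where [log_kernel_geN] begins to apply. *)
Definition abel_radius (k : nat) : R := 1 - (k.+2%:R)^-1.

Lemma abel_radius_ge k : 1 / 2 <= abel_radius k.
Proof.
rewrite /abel_radius; have : (k.+2%:R)^-1 <= (2 : R)^-1.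
  by rewrite lef_pV2 ?posrE// ler_nat.
move: (k.+2%:R^-1) => u; lra.
Qed.

Lemma abel_radius_lt1 k : abel_radius k < 1.
Proof. by rewrite /abel_radius ltrBlDr ltrDl invr_gt0. Qed.

Lemma abel_radius_in k : 0 < abel_radius k < 1.
Proof. by rewrite abel_radius_lt1 (lt_le_trans _ (abel_radius_ge k)). Qed.

Lemma abel_radius_mono m n : (m <= n)%N -> abel_radius m <= abel_radius n.
Proof.
by move=> mn; rewrite /abel_radius lerD2l lerN2 lef_pV2 ?posrE// ler_nat !ltnS.
Qed.

Lemma abel_radius_cvg : abel_radius k @[k --> \oo] --> (1 : R).
Proof.
rewrite -[X in _ --> X](subr0 1).
apply: cvgB; first exact: cvg_cst.
have := @cvg_harmonic R; rewrite -(cvg_shiftS _); exact.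
Qed.

Lemma joukowski_abel_radius_cvg : joukowski (abel_radius k) @[k --> \oo] --> (1 : R).
Proof.
have -> : 1 = (1 + 1^-1) / 2 :> R by rewrite invr1; field.
apply: cvgM; last exact: cvg_cst.
apply: cvgD; first exact: abel_radius_cvg.
by apply: cvgV; [exact: oner_neq0|exact: abel_radius_cvg].
Qed.

Lemma kernel_arg_cvg (x y : R) :
  (joukowski (abel_radius k) - x * y) ^+ 2 - (1 - x ^+ 2) * (1 - y ^+ 2)
   @[k --> \oo] --> (x - y) ^+ 2.
Proof.
have -> : (x - y) ^+ 2 = (1 - x * y) * (1 - x * y) - (1 - x ^+ 2) * (1 - y ^+ 2).
  by ring.
have h : joukowski (abel_radius k) - x * y @[k --> \oo] --> 1 - x * y.
  by apply: cvgB; [exact: joukowski_abel_radius_cvg|exact: cvg_cst].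
apply: cvgB; last exact: cvg_cst.
by under eq_fun do rewrite expr2; exact: cvgM.
Qed.

(** Convergence includes the diagonal [x = y], where the limit is [+oo]. *)
Lemma log_kernel_cvg (x y : R) : -1 <= x <= 1 -> -1 <= y <= 1 ->
  (log_kernel (abel_radius k) x y)%:E @[k --> \oo] --> (- lne `|x - y|%:E)%E.
Proof.
move=> hx hy; have := @kernel_arg_cvg x y.
have [<-|xy] := eqVneq x y.
  rewrite subrr normr0 le0_lneNy// expr0n => h.
  apply/cvgeyPge => A.
  have e0 : 0 < expR (- (2 * A)) :> R by exact: expR_gt0.
  move/cvgr_lt : h => /(_ _ e0); apply: filterS => k hk.
  rewrite lee_fin /log_kernel mulNr lerNr ler_pdivrMr// -ler_expR.
  rewrite lnK ?posrE ?kernel_arg_gt0 ?abel_radius_in//.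
  by rewrite (_ : - A * 2 = - (2 * A)) ?ltW//; ring.
have xy0 : 0 < `|x - y| by rewrite normr_gt0 subr_eq0.
rewrite lne_EFin// => h; apply: cvg_EFin; first exact: nearW.
have -> : - ln `|x - y| = - ln ((x - y) ^+ 2) / 2.
  by rewrite -[(x - y) ^+ 2]real_normK ?num_real// lnXn// -mulr_natr; field.
apply: cvgM; last exact: cvg_cst.
apply: cvgN; apply: continuous_cvg => //.
by apply: continuous_ln; rewrite -[(x - y) ^+ 2]real_normK ?num_real// exprn_gt0.
Qed.

End approach.

Section potential.
Context d (T : measurableType d) {R : realType}.
Variables (mu : {measure set T -> \bar R}) (D : set T) (X : T -> R).
Implicit Types (r x s : R).
Hypotheses (mD : measurable D) (muD : mu D = 1%E).
Hypotheses (mX : measurable_fun D X) (X1 : forall z, D z -> -1 <= X z <= 1).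

(** The shift by [ln 3] makes the integrand nonnegative, as [|x - X z| <= 2]. *)
Lemma integral_log_distance s x : `|s| < 1 -> chebyshev_moments mu D X s ->
  -1 <= x <= 1 ->
  (\int[mu]_(z in D) ((ln 3)%:E - lne `|x - X z|%:E) =
   (ln 3 + (ln 2 - ln (1 - 2 * s * x + s ^+ 2)))%:E)%E.
Proof.
move=> s1 ms hx.
pose g k z := (ln 3 + log_kernel (abel_radius k) x (X z))%:E.
have g0 k z : D z -> (0 <= g k z)%E.
  move=> Dz; rewrite lee_fin -lerBlDl sub0r.
  by apply: log_kernel_geN; rewrite ?abel_radius_ge ?abel_radius_lt1//; exact: X1.
have mg k : measurable_fun D (g k).
  apply/measurable_EFinP; apply: measurable_funD; first exact: measurable_cst.
  exact: measurable_log_kernel.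
have ndg z : D z -> {homo g ^~ z : m n / (m <= n)%N >-> (m <= n)%E}.
  move=> Dz m n mn; rewrite lee_fin lerD2l.
  have /andP[? ?] := @abel_radius_in R m.
  by apply: log_kernel_mono; rewrite ?abel_radius_lt1 ?abel_radius_mono//; exact: X1.
have lg z : D z -> g k z @[k --> \oo] --> ((ln 3)%:E - lne `|x - X z|%:E)%E.
  move=> Dz.
  rewrite (_ : (fun k => g k z) =
    (fun k => (ln 3)%:E + (log_kernel (abel_radius k) x (X z))%:E)%E); last first.
    by apply/funext => k; rewrite /g EFinD.
  apply: cvgeD.
  - exact: fin_num_adde_defr.
  - exact: cvg_cst.
  - by apply: log_kernel_cvg => //; exact: X1.
have ig k : (\int[mu]_(z in D) g k z = (ln 3 + (ln (2 * abel_radius k) -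
    ln (1 - 2 * (abel_radius k * s) * x + (abel_radius k * s) ^+ 2)))%:E)%E.
  have ic : mu.-integrable D (EFin \o cst (ln 3 : R)).
    by apply: (bounded_integrable mD muD (M := `|ln 3|)).
  have ik := integrable_log_kernel mD muD mX X1 (abel_radius_in k) hx.
  rewrite -(Rintegral_log_kernel mD muD mX X1 s1 ms (abel_radius_in k) hx) EFinD.
  rewrite /g; under eq_integral do rewrite EFinD.
  rewrite (integralD mD ic ik)/=; congr (_ + _)%E.
    by rewrite integral_cst// muD mule1.
  by rewrite /Rintegral fineK//; exact: (integrable_fin_num mD ik).
have := @cvg_monotone_convergence _ _ _ mu _ mD _ mg g0 ndg.
have -> : (\int[mu]_(z in D) limn (g^~ z) =
          \int[mu]_(z in D) ((ln 3)%:E - lne `|x - X z|%:E))%E.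
  by apply: eq_integral => z /set_mem Dz; apply/cvg_lim => //; exact: lg.
under eq_fun do rewrite ig.
move=> /cvg_lim <-//; apply/cvg_lim => //.
apply: cvg_EFin; first exact: nearW.
have hr := @abel_radius_cvg R.
have hrs : abel_radius k * s @[k --> \oo] --> s.
  rewrite -[X in _ --> X]mul1r; apply: cvgM => //; exact: cvg_cst.
apply: cvgD; first exact: cvg_cst.
apply: cvgB.
  apply: continuous_cvg; first by apply: continuous_ln.
  rewrite -[X in _ --> X]mulr1; apply: cvgM => //; exact: cvg_cst.
apply: continuous_cvg; first by apply: continuous_ln; exact: quadratic_gt0.
apply: cvgD; last by under eq_fun do rewrite expr2; rewrite expr2; exact: cvgM.
apply: cvgB; first exact: cvg_cst.
apply: cvgM; last exact: cvg_cst.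
by apply: cvgM => //; exact: cvg_cst.
Qed.

End potential.

(** * Logarithmic potentials on a segment *)

Section concentrated.
Local Open Scope ereal_scope.
Context d (T : measurableType d) {R : realType}.
Variables (mu : {measure set T -> \bar R}) (D : set T).
Hypotheses (mD : measurable D) (muD : mu (~` D) = 0).

(** The integrals may be infinite or of the form [+oo - oo]: positive and negative parts
are compared separately. *)
Lemma le_integral_concentrated (f g : T -> \bar R) :
  measurable_fun setT f -> measurable_fun setT g ->
  (forall z, D z -> f z <= g z) -> \int[mu]_z f z <= \int[mu]_z g z.
Proof.
move=> mf mg fg.
have ae (u v : T -> \bar R) : (forall z, D z -> u z <= v z) ->
    {ae mu, forall z, setT z -> u z <= v z}.
  move=> uv; exists (~` D); split => //; first exact: measurableC.
  by move=> z; apply: contra_not => Dz _; exact: uv.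
have fg' : {in D, forall z, f z <= g z} by move=> z /set_mem; exact: fg.
rewrite integralE [leRHS]integralE; apply: leeB; apply: ae_ge0_le_integral => //;
  do ?[exact: measurable_funepos | exact: measurable_funeneg];
  apply: ae => z Dz.
- exact: (funepos_le fg' (mem_set Dz)).
- exact: (funeneg_le fg' (mem_set Dz)).
Qed.

Lemma integral_concentrated (f : T -> \bar R) : measurable_fun setT f ->
  \int[mu]_z f z = \int[mu]_(z in D) f z.
Proof.
move=> mf; rewrite [RHS]integral_mkcond.
have mfD : measurable_fun setT (f \_ D).
  by apply/(measurable_restrictT _ mD); apply: measurable_funTS.
by apply/eqP; rewrite eq_le !le_integral_concentrated//= => z Dz;
  rewrite patchE mem_set.
Qed.

Lemma integrable_concentrated (f : T -> \bar R) : measurable_fun setT f ->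
  mu.-integrable D f -> mu.-integrable setT f.
Proof.
move=> mf fD; apply/(negligible_integrable _ _ mf muD) => //.
  exact: measurableC.
by rewrite setTD setCK.
Qed.

End concentrated.

Section plane_measurability.
Context {R : realType}.
Implicit Types (z w : plane R).

Lemma logabsE (w : R[i]) :
  logabs w = lne (Num.sqrt (complex.Re w ^+ 2 + complex.Im w ^+ 2))%:E.
Proof. by rewrite /logabs normc_def. Qed.

Lemma logabs_real (c : R) : logabs (Complex c 0) = lne `|c|%:E.
Proof. by rewrite logabsE/= expr0n/= addr0 sqrtr_sqr. Qed.

Lemma measurable_lne_EFin : measurable_fun setT (fun r : R => lne r%:E).
Proof.
apply: measurable_fun_ifT => //=.
  by apply: measurable_fun_ler => //; exact: measurable_cst.
by apply/measurable_EFinP; exact: measurable_ln.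
Qed.

Lemma measurable_sqrt : measurable_fun setT (@Num.sqrt R).
Proof. by apply: continuous_measurable_fun => x; exact: sqrt_continuous. Qed.

Lemma measurable_logabs d (T : measurableType d) (f g : T -> R) :
  measurable_fun setT f -> measurable_fun setT g ->
  measurable_fun setT (fun t => logabs (Complex (f t) (g t))).
Proof.
move=> mf mg; under eq_fun do rewrite logabsE /=.
apply: (@measurableT_comp _ _ _ _ _ _ (fun r : R => lne r%:E)).
  exact: measurable_lne_EFin.
apply: (@measurableT_comp _ _ _ _ _ _ (@Num.sqrt R)).
  exact: measurable_sqrt.
by apply: measurable_funD; exact: measurable_funX.
Qed.

Lemma measurable_logabs_sub (c : R[i]) :
  measurable_fun setT (fun z : plane R => logabs (toC z - c)).
Proof.
apply: (eq_measurable_fun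
  (fun z => logabs (Complex (z.1 - complex.Re c) (z.2 - complex.Im c)))).
  by move=> z _; case: c.
by apply: measurable_logabs; apply: measurable_funB => //; exact: measurable_cst.
Qed.

Lemma measurable_logabs_difference :
  measurable_fun setT (fun p : plane R * plane R => logabs (toC p.1 - toC p.2)).
Proof.
apply: (@measurable_logabs _ _ (fun p : plane R * plane R => p.1.1 - p.2.1)
   (fun p => p.1.2 - p.2.2)); apply: measurable_funB;
  exact: measurableT_comp.
Qed.

(** By Tonelli's theorem for the positive and for the negative part of the kernel. *)
Lemma measurable_inner_energy (mu : probability (plane R) R) :
  measurable_fun setT (fun z => \int[mu]_w (- logabs (toC z - toC w)%R))%E.
Proof.
under eq_fun do rewrite integralE.
have m : measurable_fun setT
    (fun p : plane R * plane R => - logabs (toC p.1 - toC p.2)%R)%E.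
  by apply: measurableT_comp => //; exact: measurable_logabs_difference.
apply: emeasurable_funB.
- apply: (eq_measurable_fun (fubini_F mu
    (fun p : plane R * plane R => - logabs (toC p.1 - toC p.2)%R)^\+%E)).
    by move=> z _; apply: eq_integral => w _; rewrite !funeposE.
  exact: (measurable_fun_fubini_tonelli_F _ (measurable_funepos m)
    (fun p => funepos_ge0 _ p)).
- apply: (eq_measurable_fun (fubini_F mu
    (fun p : plane R * plane R => - logabs (toC p.1 - toC p.2)%R)^\-%E)).
    by move=> z _; apply: eq_integral => w _; rewrite !funenegE.
  exact: (measurable_fun_fubini_tonelli_F _ (measurable_funeneg m)
    (fun p => funeneg_ge0 _ p)).
Qed.

End plane_measurability.

Section segment_measure.
Context {R : realType}.
Variables (a b : R).
Hypothesis ab : a < b.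
Let K : set (plane R) := segment a b.
Let half : R := (b - a) / 2.

(** The affine coordinate that sends [segment a b] onto [[-1, 1]]. *)
Definition ncoord (z : plane R) : R := (z.1 - (a + b) / 2) / ((b - a) / 2).

Lemma half_length_gt0 : 0 < half.
Proof. by rewrite divr_gt0// subr_gt0. Qed.

Lemma measurable_segment : measurable K.
Proof.
have -> : K = (@fst R R @^-1` `[a, b]%classic) `&` (@snd R R @^-1` [set 0]).
  by apply/seteqP; split => z; rewrite /K /segment/= in_itv.
apply: measurableI; rewrite -[X in measurable X]setTI.
  by apply: measurable_fst => //; exact: measurable_itv.
by apply: measurable_snd.
Qed.

Lemma measurable_ncoord : measurable_fun setT ncoord.
Proof.
apply: measurable_funM; last exact: measurable_cst.
by apply: measurable_funB => //; exact: measurable_cst.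
Qed.

Lemma ncoord_in z : K z -> -1 <= ncoord z <= 1.
Proof.
have h0 := half_length_gt0; rewrite /half in h0.
move=> [/andP[z1 z2] _]; rewrite /ncoord ler_pdivlMr// ler_pdivrMr//.
by apply/andP; split; lra.
Qed.

Lemma supported_segment (mu : probability (plane R) R) :
  supported K mu -> mu K = 1%E.
Proof.
move=> h; have := probability_setC mu (measurableC measurable_segment).
by rewrite setCK h sube0.
Qed.

Lemma logabs_segment z w : K z -> K w ->
  (logabs (toC z - toC w)%R = (ln half + ln 3)%:E -
    ((ln 3)%:E - lne `|ncoord z - ncoord w|%R%:E))%E.
Proof.
have h0 := half_length_gt0.
case: z w => [z1 z2] [w1 w2] [_ z0] [_ w0].
rewrite /= in z0 w0; subst z2 w2.
have -> : toC (z1, 0) - toC (w1, 0) = Complex (z1 - w1) 0 :> R[i].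
  by rewrite /toC/=; simpc.
rewrite logabs_real.
have -> : `|z1 - w1| = half * `|ncoord (z1, 0) - ncoord (w1, 0)|.
  rewrite -[X in X * _](gtr0_norm h0) -normrM; congr `|_|.
  by rewrite /ncoord /half /=; field; rewrite subr_eq0 gt_eqF.
have [->|n0] := eqVneq `|ncoord (z1, 0) - ncoord (w1, 0)| 0.
  by rewrite mulr0 le0_lneNy.
have {}n0 : 0 < `|ncoord (z1, 0) - ncoord (w1, 0)| by rewrite lt_def n0/=.
rewrite (lne_EFin (mulr_gt0 h0 n0)) (lne_EFin n0) lnM ?posrE // -!EFinB.
congr EFin; ring.
Qed.

Section log_potential.
Variables (mu : probability (plane R) R) (s : R).
Hypotheses (muK : supported K mu) (s1 : `|s| < 1).
Hypothesis ms : chebyshev_moments mu K ncoord s.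

(** On [K] the integrand differs by a constant from that of [integral_log_distance];
integrability comes from the finiteness of the nonnegative integral there. *)
Lemma log_potential x : K x ->
  mu.-integrable setT (fun z => logabs (toC z - toC x)) /\
  (\int[mu]_z logabs (toC z - toC x)%R =
   (ln half - ln 2 + ln (1 - 2 * s * ncoord x + s ^+ 2))%:E)%E.
Proof.
move=> Kx; have mK := measurable_segment; have mu1 := supported_segment muK.
have mX : measurable_fun K ncoord by apply: measurable_funTS; exact: measurable_ncoord.
pose g z := ((ln 3)%:E - lne `|ncoord x - ncoord z|%:E)%E.
have mg : measurable_fun K g.
  apply: emeasurable_funB; first exact: measurable_cst.
  apply: (@measurableT_comp _ _ _ _ _ _ (fun r : R => lne r%:E)).
    exact: measurable_lne_EFin.
  apply: measurableT_comp => //.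
  by apply: measurable_funB => //; exact: measurable_cst.
have X1 := ncoord_in.
have g0 z : K z -> (0 <= g z)%E.
  move=> Kz; rewrite /g sube_ge0; last by rewrite orbT.
  have [->|n0] := eqVneq `|ncoord x - ncoord z| 0; first by rewrite le0_lneNy ?leNye.
  have {}n0 : 0 < `|ncoord x - ncoord z| by rewrite lt_def n0/=.
  rewrite lne_EFin// lee_fin ler_ln ?posrE//.
  have /andP[? ?] := X1 _ Kx; have /andP[? ?] := X1 _ Kz.
  by rewrite ler_norml; apply/andP; split; lra.
(* [logabs] of the difference is the constant [ln half + ln 3] minus [g]. *)
have ig := integral_log_distance mK mu1 mX X1 s1 ms (X1 _ Kx).
have intg : mu.-integrable K g.
  apply/integrableP; split => //.
  rewrite (eq_integral g); first by rewrite ig ltry.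
  by move=> z /set_mem Kz; rewrite gee0_abs ?g0.
have intc (c : R) : mu.-integrable K (cst c%:E).
  by apply: finite_measure_integrable_cst.
have fE z : K z -> logabs (toC z - toC x) = ((ln half + ln 3)%:E - g z)%E.
  by move=> Kz; rewrite logabs_segment// /g distrC.
have intf : mu.-integrable K (fun z => logabs (toC z - toC x)).
  apply: (eq_integrable _ (fun z => (ln half + ln 3)%:E - g z)%E) => //.
    by move=> z /set_mem Kz; rewrite fE.
  exact: (integrableB mK (intc _) intg).
split.
  apply: (@integrable_concentrated _ _ _ _ K) => //.
  exact: measurable_logabs_sub.
rewrite (integral_concentrated mK muK (measurable_logabs_sub _)).
rewrite (eq_integral (fun z => (ln half + ln 3)%:E - g z)%E); last first.
  by move=> z /set_mem Kz; rewrite fE.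
rewrite (integralB mK (intc _) intg)/= ig integral_cst //= [X in (_ * X)%E]mu1 mule1 -EFinB.
by congr EFin; ring.
Qed.

End log_potential.

End segment_measure.

(** * The arcsine law and the equilibrium measure *)

Section arcsine.
Context {R : realType}.
Variables (a b : R).
Hypothesis ab : a < b.
Let K : set (plane R) := segment a b.

Definition circle_projection (t : R) : plane R :=
  ((a + b) / 2 + (b - a) / 2 * cos t, 0).

Lemma circle_projection_in t : K (circle_projection t).
Proof.
have h0 := half_length_gt0 ab; split => //=.
have c1 := cos_geN1 t; have c2 := cos_le1 t.
by apply/andP; split; nra.
Qed.

Lemma ncoord_circle_projection t : ncoord a b (circle_projection t) = cos t.
Proof.
by rewrite /ncoord/=; field; rewrite subr_eq0 gt_eqF.
Qed.

Lemma measurable_circle_projection : measurable_fun setT circle_projection.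
Proof.
apply/measurable_fun_pairP; split; last exact: measurable_cst.
apply: measurable_funD; first exact: measurable_cst.
apply: measurable_funM; first exact: measurable_cst.
by apply: continuous_measurable_fun; exact: continuous_cos.
Qed.

Definition circle_projection_mfun : {mfun measurableTypeR R >-> plane R} :=
  MeasurableFun.Pack (MeasurableFun.Class
    (isMeasurableFun.Build _ _ (measurableTypeR R) (plane R) circle_projection
       measurable_circle_projection)).

(** The image of the uniform law on the upper half circle under projection to its
diameter; the substitution [X = cos t] makes the moments trigonometric integrals. *)
Definition arcsine_law : probability (plane R) R :=
  distribution (uniform_prob (@pi_gt0 R)) circle_projection_mfun.

Lemma arcsine_supported : supported K arcsine_law.
Proof.
rewrite /supported /arcsine_law /= /distribution /pushforward/=.
rewrite (_ : _ @^-1` _ = set0) ?measure0//.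
by apply/seteqP; split => // t /=; have := circle_projection_in t.
Qed.

Lemma integral_cos_multiple n :
  (\int[@lebesgue_measure R]_(t in `[0%R, pi]) (1 + cos (n.+1%:R * t))%:E
   = pi%:E)%E.
Proof.
pose F (t : R) := t + sin (n.+1%:R * t) / n.+1%:R.
have dF (t : R) : is_derive t 1 F (1 + cos (n.+1%:R * t)).
  have d1 : is_derive t (1 : R) (fun t : R => n.+1%:R * t) n.+1%:R.
    by apply: (is_derive_eq (is_deriveZ n.+1%:R (is_derive_id t 1)));
      rewrite /GRing.scale/= mulr1.
  have d2 := is_derive1_comp (is_derive_sin _) d1.
  have d3 := is_deriveD (is_derive_id t 1) (is_deriveZ (n.+1%:R^-1) d2).
  have -> : F = id + n.+1%:R^-1 \*: (sin \o (fun t : R => n.+1%:R * t)).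
    by apply/funext => u; rewrite /F /= mulrC.
  apply: (is_derive_eq d3); congr (_ + _); rewrite /GRing.scale/=.
  by rewrite mulrCA mulVf ?mulr1// pnatr_eq0.
have cF (t : R) : {for t, continuous F}.
  by apply/differentiable_continuous/derivable1_diffP; case: (dF t).
rewrite (@continuous_FTC2 _ _ F).
- rewrite /F mulr0 sin0 mul0r addr0 -EFinD oppr0 addr0.
  have -> : sin (n.+1%:R * pi) = 0 :> R.
    elim: (n.+1) => [|k IH]; first by rewrite mul0r sin0.
    by rewrite -natr1 mulrDl mul1r sinD IH sinpi mul0r mulr0 addr0.
  by rewrite mul0r addr0.
- exact: pi_gt0.
- apply: continuous_subspaceT => t; apply: continuousD; first exact: cst_continuous.
  apply: continuous_comp; last exact: continuous_cos.
  exact: mulrl_continuous.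
- split=> [t _||].
  + by case: (dF t).
  + by apply: cvg_at_right_filter; exact: cF.
  + by apply: cvg_at_left_filter; exact: cF.
- by move=> t _; rewrite derive1E; case: (dF t).
Qed.

(** [1 + T_n] is integrated instead of [T_n], to stay with nonnegative functions. *)
Lemma arcsine_moments : chebyshev_moments arcsine_law K (ncoord a b) 0.
Proof.
have mK := measurable_segment a b.
have mu1 := supported_segment arcsine_supported.
have mX : measurable_fun K (ncoord a b).
  by apply: measurable_funTS; exact: measurable_ncoord.
have X1 := ncoord_in ab.
case=> [|n].
  by rewrite expr0 Rintegral_cst// [X in fine X]mu1 mulr1.
rewrite expr0n /=.
have ic : arcsine_law.-integrable K (EFin \o cst 1).
  by apply: (bounded_integrable mK mu1 (M := `|1|)).
have it := integrable_chebT mK mu1 mX X1 n.+1.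
have h : (\int[arcsine_law]_(z in K) (1 + chebT n.+1 (ncoord a b z))%:E = 1)%E.
  rewrite /arcsine_law /= /distribution ge0_integral_pushforward//; last 2 first.
  - apply/measurable_EFinP; apply: measurable_funD; first exact: measurable_cst.
    exact: measurable_chebT.
  - move=> z /set_mem Kz; have := chebT_norm_le1 n.+1 (X1 _ Kz).
    by rewrite lee_fin ler_norml => /andP[? ?]; lra.
  rewrite (_ : _ @^-1` _ = setT); last first.
    by apply/seteqP; split => // t _; exact: circle_projection_in.
  rewrite (eq_integral (fun t : measurableTypeR R => (1 + cos (n.+1%:R * (t : R)))%:E)); last first.
    by move=> t _; rewrite /= ncoord_circle_projection chebT_cos.
  rewrite integral_uniform.
  - rewrite integral_cos_multiple subr0 -EFinM mulVf// gt_eqF//.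
    exact: pi_gt0.
  - apply/measurable_EFinP; apply: continuous_measurable_fun => t.
    apply: continuousD; first exact: cst_continuous.
    apply: continuous_comp; last exact: continuous_cos.
    exact: mulrl_continuous.
  - by move=> t; rewrite lee_fin -lerBlDl sub0r cos_geN1.
have := RintegralD mK ic it; rewrite Rintegral_cst// [X in fine X]mu1 mulr1.
rewrite [X in X = _]/Rintegral h /= => e.
by apply: (addrI 1); rewrite addr0 -e.
Qed.

End arcsine.

Section equilibrium.
Context {R : realType}.
Variables (a b : R).
Hypothesis ab : a < b.
Let K : set (plane R) := segment a b.
Let X : plane R -> R := ncoord a b.
Let mK : measurable K := measurable_segment a b.
Let X1 : forall z, K z -> -1 <= X z <= 1 := ncoord_in ab.
Let mX : measurable_fun setT X := measurable_ncoord a b.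
Let mXK : measurable_fun K X := measurable_funTS mX.

Lemma logabs_subC (z w : R[i]) : logabs (z - w) = logabs (w - z).
Proof. by rewrite /logabs distrC. Qed.

(** The potential is constant on [K] because all moments vanish. *)
Lemma arcsine_energy :
  (energy (arcsine_law a b) <= (ln 2 - ln ((b - a) / 2))%:E)%E.
Proof.
set mu := arcsine_law a b; have muK := arcsine_supported ab.
rewrite /energy.
apply: (@le_trans _ _ (\int[mu]_z (ln 2 - ln ((b - a) / 2))%:E)%E); last first.
  by rewrite integral_cst// [X in (_ * X)%E]probability_setT mule1.
apply: (le_integral_concentrated mK muK).
- exact: measurable_inner_energy.
- exact: measurable_cst.
- move=> z Kz.
  have s1 : `|0 : R| < 1 by rewrite normr0.
  have [iz ez] := log_potential ab muK s1 (arcsine_moments ab) Kz.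
  rewrite (eq_integral (fun w : plane R => - logabs (toC w - toC z)%R)%E); last first.
    by move=> w _; rewrite logabs_subC.
  rewrite integralN; last exact: integrable_add_def.
  rewrite ez mulr0 mul0r subr0 expr0n/= addr0 ln1 addr0 -?EFinN lee_fin.
  by rewrite opprB.
Qed.

Variable nu : probability (plane R) R.
Hypothesis nuK : supported K nu.
Let nu1 : nu K = 1%E := supported_segment nuK.
Let c n : R := \int[nu]_(z in K) chebT n (X z).

Lemma integral_supported_chebT_sum N u (k : R) :
  (\int[nu]_z (k + chebT_sum N u (X z))%:E =
   (k + \sum_(i < N) u i * c i.+1)%:E)%E.
Proof.
rewrite (integral_concentrated mK nuK); last first.
  apply/measurable_EFinP; apply: measurable_funD; first exact: measurable_cst.
  exact: (measurable_chebT_sum mX).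
exact: (integral_shifted_chebT_sum mK nu1 mXK X1).
Qed.

Lemma energy_kernel_ge N r z w : 0 < r < 1 -> K z -> K w ->
  ((ln 2 - ln ((b - a) / 2) + ln r - 4 * r ^+ N / (1 - r) ^+ 2 +
   kernel_partial N r (X z) (X w))%:E <= - logabs (toC z - toC w)%R)%E.
Proof.
move=> hr Kz Kw; rewrite (logabs_segment ab Kz Kw) -/(X z) -/(X w).
have [->|zw] := eqVneq (X z) (X w).
  by rewrite subrr normr0 le0_lneNy//= leey.
have zw0 : 0 < `|X z - X w| by rewrite normr_gt0 subr_eq0.
rewrite lne_EFin// -!EFinB -EFinN lee_fin.
have := log_kernel_expansion N hr (X1 Kz) (X1 Kw).
have := log_kernel_le hr (X1 Kz) (X1 Kw) zw.
have /andP[r0 _] := hr; rewrite lnM ?posrE//.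
rewrite ler_norml => h1 /andP[h2 h3].
set e := _ / _ in h2 h3 *; set l := ln (_ / 2); lra.
Qed.

(** The energy dominates the quadratic form of the kernel, which the expansion makes
diagonal in the Chebyshev moments, with positive coefficients. *)
Lemma energy_ge N r : 0 < r < 1 ->
  ((ln 2 - ln ((b - a) / 2) + ln r - 4 * r ^+ N / (1 - r) ^+ 2 +
    \sum_(i < N) 2 * r ^+ i.+1 / i.+1%:R * c i.+1 ^+ 2)%:E <= energy nu)%E.
Proof.
move=> hr; set k := ln 2 - _ + _ - _.
pose w i := 2 * r ^+ i.+1 / i.+1%:R : R.
pose v i := w i * c i.+1.
have mS N' u : measurable_fun setT (fun z => (k + chebT_sum N' u (X z))%:E).
  apply/measurable_EFinP; apply: measurable_funD; first exact: measurable_cst.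
  exact: (measurable_chebT_sum mX).
have inner z : K z -> ((k + chebT_sum N v (X z))%:E <=
    \int[nu]_w (- logabs (toC z - toC w)%R))%E.
  move=> Kz.
  have -> : chebT_sum N v (X z) = \sum_(i < N) (w i * chebT i.+1 (X z)) * c i.+1.
    by apply: eq_bigr => i _; rewrite /v mulrAC.
  rewrite -(integral_supported_chebT_sum N (fun i => w i * chebT i.+1 (X z))).
  apply: (le_integral_concentrated mK nuK) => //.
  - apply: measurableT_comp => //.
    apply: (eq_measurable_fun (fun y : plane R => logabs (toC y - toC z))) => [y _|].
      exact: logabs_subC.
    exact: measurable_logabs_sub.
  - by move=> y Ky; exact: energy_kernel_ge.
rewrite /energy; apply: le_trans; last first.
  apply: (le_integral_concentrated mK nuK (mS N v) _ inner).
  exact: measurable_inner_energy.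
rewrite integral_supported_chebT_sum lee_fin lerD2l.
by apply: ler_sum => i _; rewrite /v /w expr2 mulrA.
Qed.

(** Compared with [arcsine_energy], [energy_ge] leaves
[(2 r^n / n) c_n ^ 2 <= - ln r] for all [r < 1]; the right side tends to 0 with
[r] tending to 1. *)
Lemma equilibrium_moments : is_equilibrium_measure K nu ->
  chebyshev_moments nu K X 0.
Proof.
move=> [_ nu_min]; have hV := le_trans (nu_min _ (arcsine_supported ab)) arcsine_energy.
case=> [|n].
  by rewrite expr0 Rintegral_cst// [X in fine X]nu1 mulr1.
rewrite expr0n/= -/(c n.+1).
have step (r : R) : 0 < r < 1 -> 2 * r ^+ n.+1 / n.+1%:R * c n.+1 ^+ 2 <= - ln r.
  move=> hr; have /andP[r0 r1] := hr.
  have t0 i : 0 <= 2 * r ^+ i.+1 / i.+1%:R * c i.+1 ^+ 2.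
    by rewrite mulr_ge0 ?sqr_ge0// divr_ge0// mulr_ge0// exprn_ge0// ltW.
  rewrite -subr_le0; apply: (ler_cvg_to (cvg_cst _) (kernel_error_cvg0 hr)).
  near=> N.
  have nN : (n < N)%N by near: N; exact: nbhs_infty_gt.
  have := le_trans (energy_ge N hr) hV; rewrite lee_fin.
  have : 2 * r ^+ n.+1 / n.+1%:R * c n.+1 ^+ 2 <=
      \sum_(i < N) 2 * r ^+ i.+1 / i.+1%:R * c i.+1 ^+ 2.
    by rewrite (bigD1 (Ordinal nN))//= lerDl sumr_ge0.
  set e := _ / (1 - r) ^+ 2; set S := \sum_(i < N) _.
  set y := 2 * _ / _ * _; lra.
(* As [- ln r] tends to 0, the coefficient of [c n.+1 ^+ 2] stays positive. *)
have lim : 2 * abel_radius k ^+ n.+1 / n.+1%:R * c n.+1 ^+ 2 + ln (abel_radius k) @[k --> \oo]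
    --> 2 * 1 ^+ n.+1 / n.+1%:R * c n.+1 ^+ 2 + ln 1.
  have hr := @abel_radius_cvg R.
  apply: cvgD; last by apply: continuous_cvg => //; exact: continuous_ln.
  apply: cvgM; last exact: cvg_cst.
  apply: cvgM; last exact: cvg_cst.
  apply: cvgM; first exact: cvg_cst.
  apply: (@cvg_comp _ _ _ (fun k => abel_radius k) (fun y : R => y ^+ n.+1) _ _ _ hr).
  exact: exprn_continuous.
have : 2 * 1 ^+ n.+1 / n.+1%:R * c n.+1 ^+ 2 + ln 1 <= 0.
  apply: (ler_cvg_to lim (cvg_cst 0)); apply: nearW => k.
  by have := step _ (abel_radius_in k); rewrite -subr_le0 opprK.
rewrite expr1n mulr1 ln1 addr0 pmulr_rle0 ?divr_gt0//.
by move=> h; apply/eqP; rewrite -sqrf_eq0 eq_le sqr_ge0 andbT.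
Unshelve. all: by end_near. Qed.

End equilibrium.

(** * Complex differentiable functions on the plane *)

Section directional_derivatives.
Context {R : realType}.
Implicit Types (f g : plane R -> R) (z v : plane R).

(** Reduces directional derivatives to one real variable, where the chain rule is
available. *)
Lemma is_derive_lineP f z v (df : R) :
  is_derive z v f df <-> is_derive (0 : R) 1 (fun h : R => f (h *: v + z)) df.
Proof.
have e : (fun h : R => h^-1 *: ((f \o shift z) (h *: v) - f z)) =
  (fun h : R => h^-1 *: (((fun h : R => f (h *: v + z)) \o shift 0) (h *: 1)
     - f (0 *: v + z))).
  by apply/funext => h /=; rewrite addr0 scale0r add0r /GRing.scale/= mulr1.
by split=> -[c l]; split; move: c l; rewrite /derivable /derive /= e.
Qed.

Lemma is_derive_comp1 f (g : R -> R) z v (df dg : R) :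
  is_derive (f z) 1 g dg -> is_derive z v f df ->
  is_derive z v (fun w => g (f w)) (dg * df).
Proof.
move=> hg /is_derive_lineP hf; apply/is_derive_lineP.
by apply: (@is_derive1_comp _ g (fun h : R => f (h *: v + z)));
  rewrite ?scale0r ?add0r.
Qed.

End directional_derivatives.

Section holomorphic.
Context {R : realType}.
Implicit Types (F G : plane R -> R[i]) (z v w : plane R).
Local Notation Re := (@complex.Re R).
Local Notation Im := (@complex.Im R).

Lemma cReM (x y : R[i]) : Re (x * y) = Re x * Re y - Im x * Im y.
Proof. by case: x => ? ?; case: y. Qed.

Lemma cImM (x y : R[i]) : Im (x * y) = Re x * Im y + Im x * Re y.
Proof. by case: x => ? ?; case: y. Qed.

Lemma cReD (x y : R[i]) : Re (x + y) = Re x + Re y.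
Proof. by case: x => ? ?; case: y. Qed.

Lemma cImD (x y : R[i]) : Im (x + y) = Im x + Im y.
Proof. by case: x => ? ?; case: y. Qed.

Lemma cReN (x : R[i]) : Re (- x) = - Re x.
Proof. by case: x. Qed.

Lemma cImN (x : R[i]) : Im (- x) = - Im x.
Proof. by case: x. Qed.

Lemma cReV (x : R[i]) : Re x^-1 = Re x / (Re x ^+ 2 + Im x ^+ 2).
Proof. by case: x. Qed.

Lemma cImV (x : R[i]) : Im x^-1 = - Im x / (Re x ^+ 2 + Im x ^+ 2).
Proof. by case: x => a b; rewrite [LHS]/= mulNr. Qed.

Lemma complex_eq (x y : R[i]) : Re x = Re y -> Im x = Im y -> x = y.
Proof. by case: x => ? ?; case: y => ? ? /= -> ->. Qed.

Lemma sq_modulus_gt0 (x : R[i]) : x != 0 -> 0 < Re x ^+ 2 + Im x ^+ 2.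
Proof.
case: x => a b; rewrite eq_complex/= => h.
rewrite lt_def addr_ge0 ?sqr_ge0// andbT paddr_eq0 ?sqr_ge0//.
by rewrite !sqrf_eq0.
Qed.

Definition cderive F z v (c : R[i]) :=
  is_derive z v (fun w => Re (F w)) (Re c) /\
  is_derive z v (fun w => Im (F w)) (Im c).

Definition ccontinuous F z :=
  continuous_at z (fun w => Re (F w)) /\ continuous_at z (fun w => Im (F w)).

(** Complex differentiability with derivative [c], tested in the two coordinate
directions only: this is what second partial derivatives need, and it contains the
Cauchy-Riemann equations. *)
Definition holomorphic_at F z (c : R[i]) :=
  forall v, coord_vectors v -> cderive F z v (toC v * c).

(** [k] complex derivatives near a point. The derivative is existentially quantified
at each level, so that closure under an operation follows by induction on [k] from the
formula for one derivative. *)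
Fixpoint smooth (k : nat) F z : Prop :=
  ccontinuous F z /\
  if k is k'.+1 then
    exists G, (\forall w \near z, holomorphic_at F w (G w)) /\ smooth k' G z
  else True.

Lemma smooth_continuous k F z : smooth k F z -> ccontinuous F z.
Proof. by case: k => [|k] []. Qed.

Lemma smoothS k F z : smooth k.+1 F z -> smooth k F z.
Proof.
elim: k F => [|k IH] F; first by move=> [c _].
by move=> [c [G [FG /IH sG]]]; split=> //; exists G.
Qed.

Lemma ccontinuousD F G z : ccontinuous F z -> ccontinuous G z ->
  ccontinuous (fun w => F w + G w) z.
Proof.
move=> [F1 F2] [G1 G2]; split.
  by under eq_fun do rewrite cReD; exact: continuousD.
by under eq_fun do rewrite cImD; exact: continuousD.
Qed.

Lemma ccontinuousM F G z : ccontinuous F z -> ccontinuous G z ->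
  ccontinuous (fun w => F w * G w) z.
Proof.
move=> [F1 F2] [G1 G2]; split.
  under eq_fun do rewrite cReM.
  exact: (continuousB (continuousM F1 G1) (continuousM F2 G2)).
under eq_fun do rewrite cImM.
exact: (continuousD (continuousM F1 G2) (continuousM F2 G1)).
Qed.

Lemma ccontinuous_sq_modulus F z : ccontinuous F z ->
  continuous_at z (fun w => Re (F w) ^+ 2 + Im (F w) ^+ 2).
Proof.
move=> [F1 F2]; under eq_fun do rewrite !expr2.
exact: (continuousD (continuousM F1 F1) (continuousM F2 F2)).
Qed.

Lemma ccontinuousV F z : F z != 0 -> ccontinuous F z ->
  ccontinuous (fun w => (F w)^-1) z.
Proof.
move=> Fz cF; have h := ccontinuous_sq_modulus cF.
have [F1 F2] := cF.
have n1 : Re (F z) ^+ 2 + Im (F z) ^+ 2 != 0 by rewrite gt_eqF ?sq_modulus_gt0.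
split.
  under eq_fun do rewrite cReV.
  by apply: cvgM; [exact: F1|apply: cvgV].
under eq_fun do rewrite cImV.
by apply: cvgM; [apply: cvgN|apply: cvgV].
Qed.

Lemma ccontinuous_cst c z : ccontinuous (fun=> c) z.
Proof. by split; exact: cst_continuous. Qed.

Lemma holomorphic_atD F G z c d : holomorphic_at F z c -> holomorphic_at G z d ->
  holomorphic_at (fun w => F w + G w) z (c + d).
Proof.
move=> hF hG v hv; have [F1 F2] := hF v hv; have [G1 G2] := hG v hv; split.
  under eq_fun do rewrite cReD.
  by apply: (is_derive_eq (is_deriveD F1 G1)); rewrite mulrDr cReD.
under eq_fun do rewrite cImD.
by apply: (is_derive_eq (is_deriveD F2 G2)); rewrite mulrDr cImD.
Qed.

Lemma holomorphic_atM F G z c d : holomorphic_at F z c -> holomorphic_at G z d ->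
  holomorphic_at (fun w => F w * G w) z (c * G z + F z * d).
Proof.
move=> hF hG v hv; have [F1 F2] := hF v hv; have [G1 G2] := hG v hv; split.
  under eq_fun do rewrite cReM.
  apply: (is_derive_eq (is_deriveB (is_deriveM F1 G1) (is_deriveM F2 G2))).
  by rewrite /GRing.scale/= !(cReM, cImM, cReD, cImD); ring.
under eq_fun do rewrite cImM.
apply: (is_derive_eq (is_deriveD (is_deriveM F1 G2) (is_deriveM F2 G1))).
by rewrite /GRing.scale/= !(cReM, cImM, cReD, cImD); ring.
Qed.

Lemma is_derive1_inv (x : R) : x != 0 -> is_derive x 1 (fun y : R => y^-1) (- x ^- 2).
Proof.
move=> x0; have := @is_deriveV _ (@id R) x 1 1 x0 (is_derive_id x 1).
by move=> h; apply: (is_derive_eq h); rewrite /GRing.scale/= mulr1.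
Qed.

Lemma holomorphic_atV F z c : F z != 0 -> holomorphic_at F z c ->
  holomorphic_at (fun w => (F w)^-1) z (- c * ((F z)^-1 * (F z)^-1)).
Proof.
move=> Fz hF v hv; have [F1 F2] := hF v hv.
have n0 := sq_modulus_gt0 Fz.
have n1 : Re (F z) ^+ 2 + Im (F z) ^+ 2 != 0 by rewrite gt_eqF.
pose q w := Re (F w) * Re (F w) + Im (F w) * Im (F w).
have qE w : q w = Re (F w) ^+ 2 + Im (F w) ^+ 2 by rewrite !expr2.
have dq : is_derive z v q _ :=
  is_deriveD (is_deriveM F1 F1) (is_deriveM F2 F2).
have qz : q z != 0 by rewrite qE.
have dqV := is_derive_comp1 (is_derive1_inv qz) dq.
split.
  have -> : (fun w => Re (F w)^-1) = (fun w => Re (F w)) * (fun w => (q w)^-1).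
    by apply/funext => w; rewrite cReV -qE.
  apply: (is_derive_eq (is_deriveM F1 dqV)).
  rewrite /GRing.scale /= qE !(cReM, cImM, cReV, cImV) cReN cImN.
  by field.
have -> : (fun w => Im (F w)^-1) =
    (fun w => - Im (F w)) * (fun w => (q w)^-1).
  by apply/funext => w; rewrite cImV -qE.
have F2N : is_derive z v (fun w => - Im (F w)) _ := is_deriveN F2.
apply: (is_derive_eq (is_deriveM F2N dqV)).
rewrite /GRing.scale /= qE !(cReM, cImM, cReV, cImV) cReN cImN.
by field.
Qed.

Lemma holomorphic_at_cst c z : holomorphic_at (fun=> c) z 0.
Proof.
by move=> v _; rewrite mulr0; split; exact: is_derive_cst.
Qed.

Lemma holomorphic_at_toC z : holomorphic_at toC z 1.
Proof.
move=> v _; rewrite mulr1; split => /=.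
  apply/is_derive_lineP => /=.
  have := is_deriveD (is_deriveZ v.1 (is_derive_id (0 : R) 1))
     (is_derive_cst z.1 (0 : R) 1).
  set g := (X in is_derive _ _ X _).
  have -> : g = (fun h : R => h *: v.1 + z.1).
    by apply/funext => h; rewrite /g /= /GRing.scale/= mulrC.
  by move=> h; apply: (is_derive_eq h); rewrite /GRing.scale/= mulr1 addr0.
apply/is_derive_lineP => /=.
have := is_deriveD (is_deriveZ v.2 (is_derive_id (0 : R) 1))
   (is_derive_cst z.2 (0 : R) 1).
set g := (X in is_derive _ _ X _).
have -> : g = (fun h : R => h *: v.2 + z.2).
  by apply/funext => h; rewrite /g /= /GRing.scale/= mulrC.
by move=> h; apply: (is_derive_eq h); rewrite /GRing.scale/= mulr1 addr0.
Qed.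

Lemma smooth_cst k c z : smooth k (fun=> c) z.
Proof.
elim: k c => [|k IH] c; split; try exact: ccontinuous_cst; first by [].
exists (fun=> 0); split; last exact: IH.
by near=> w; exact: holomorphic_at_cst.
Unshelve. all: by end_near. Qed.

Lemma smooth_toC k z : smooth k toC z.
Proof.
have c : ccontinuous toC z.
  by split; [apply: cvg_fst|apply: cvg_snd].
case: k => [|k]; split=> //; exists (fun=> 1); split; last exact: smooth_cst.
by near=> w; exact: holomorphic_at_toC.
Unshelve. all: by end_near. Qed.

Lemma smoothD k F G z : smooth k F z -> smooth k G z ->
  smooth k (fun w => F w + G w) z.
Proof.
elim: k F G => [|k IH] F G [cF hF] [cG hG].
  by split=> //; exact: ccontinuousD.
split; first exact: ccontinuousD.
move: hF hG => [F' [F1 F2]] [G' [G1 G2]].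
exists (fun w => F' w + G' w); split; last exact: IH.
by near do apply: holomorphic_atD.
Unshelve. all: by end_near. Qed.

Lemma smoothM k F G z : smooth k F z -> smooth k G z ->
  smooth k (fun w => F w * G w) z.
Proof.
elim: k F G => [|k IH] F G.
  by move=> [cF _] [cG _]; split=> //; exact: ccontinuousM.
move=> /[dup] /smoothS sF [cF [F' [F1 F2]]] /[dup] /smoothS sG [cG [G' [G1 G2]]].
split; first exact: ccontinuousM.
exists (fun w => F' w * G w + F w * G' w); split.
  by near do apply: holomorphic_atM.
by apply: smoothD; exact: IH.
Unshelve. all: by end_near. Qed.

Lemma smoothX k F z n : smooth k F z -> smooth k (fun w => F w ^+ n) z.
Proof.
move=> sF; elim: n => [|n IH]; first exact: smooth_cst.
by under eq_fun do rewrite exprS; exact: smoothM.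
Qed.

Lemma ccontinuous_neq0 F z : ccontinuous F z -> F z != 0 ->
  \forall w \near z, F w != 0.
Proof.
move=> cF Fz; have := ccontinuous_sq_modulus cF.
move=> /cvgr_gt /(_ _ (sq_modulus_gt0 Fz)); apply: filterS => w.
by apply: contraTneq => ->; rewrite /= expr0n addr0 ltxx.
Qed.

Lemma smoothV k F z : F z != 0 -> smooth k F z ->
  smooth k (fun w => (F w)^-1) z.
Proof.
move=> Fz; elim: k F Fz => [|k IH] F Fz.
  by move=> [cF _]; split=> //; exact: ccontinuousV.
move=> /[dup] /smoothS sF [cF [F' [F1 F2]]].
split; first exact: ccontinuousV.
exists (fun w => - F' w * ((F w)^-1 * (F w)^-1)); split.
  have Fw := ccontinuous_neq0 cF Fz.
  by near do apply: holomorphic_atV.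
apply: smoothM; last by apply: smoothM; exact: IH.
have -> : (fun w => - F' w) = (fun w => -1 * F' w).
  by apply/funext => w; rewrite mulN1r.
by apply: smoothM => //; exact: smooth_cst.
Unshelve. all: by end_near. Qed.

End holomorphic.

Section square_root.
Context {R : realType}.
Implicit Types (F G : plane R -> R[i]) (z v w : plane R).
Local Notation Re := (@complex.Re R).
Local Notation Im := (@complex.Im R).

(** The plane without the half-line of nonpositive reals, the domain of the principal
square root. *)
Definition slit (c : R[i]) : Prop := 0 < Re c \/ Im c != 0.

Definition csqrt_re (x y : R) : R := Num.sqrt ((Num.sqrt (x ^+ 2 + y ^+ 2) + x) / 2).

Definition csqrt (c : R[i]) : R[i] :=
  Complex (csqrt_re (Re c) (Im c)) (Im c / (2 * csqrt_re (Re c) (Im c))).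

Lemma modulus_gt (x y : R) : 0 < x \/ y != 0 ->
  0 < x ^+ 2 + y ^+ 2 /\ 0 < (Num.sqrt (x ^+ 2 + y ^+ 2) + x) / 2.
Proof.
move=> h; have n0 : 0 < x ^+ 2 + y ^+ 2.
  case: h => [x0|y0]; first by rewrite ltr_pwDl ?sqr_ge0// exprn_gt0.
  by rewrite ltr_wpDl ?sqr_ge0// lt_def sqr_ge0 sqrf_eq0 y0.
split=> //; rewrite divr_gt0//.
case: h => [x0|y0]; first by rewrite ltr_wpDl ?sqrtr_ge0.
rewrite -ltrBlDr sub0r (le_lt_trans (ler_norm _))// normrN -sqrtr_sqr.
by rewrite ltr_sqrt// ltrDl lt_def sqr_ge0 sqrf_eq0 y0.
Qed.

Lemma csqrt_re_gt0 c : slit c -> 0 < Re (csqrt c).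
Proof. by move=> /modulus_gt[_ h]; rewrite /= sqrtr_gt0. Qed.

(** With [c] and its modulus expressed as polynomials in the real and imaginary parts of
the root, the formula for the derivative of the root becomes a rational identity. *)
Lemma csqrt_re_im c : slit c ->
  [/\ Re c = Re (csqrt c) ^+ 2 - Im (csqrt c) ^+ 2,
      Im c = 2 * Re (csqrt c) * Im (csqrt c) &
      Num.sqrt (Re c ^+ 2 + Im c ^+ 2) = Re (csqrt c) ^+ 2 + Im (csqrt c) ^+ 2].
Proof.
move=> sc; have p0 := csqrt_re_gt0 sc; have [n0 h0] := modulus_gt sc.
have p2 : Re (csqrt c) ^+ 2 = (Num.sqrt (Re c ^+ 2 + Im c ^+ 2) + Re c) / 2.
  by rewrite /= sqr_sqrtr// ltW.
have pn : Re (csqrt c) != 0 by rewrite gt_eqF.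
have q1 : Im c = 2 * Re (csqrt c) * Im (csqrt c).
  rewrite [Im (csqrt c)]/= -[csqrt_re _ _]/(Re (csqrt c)).
  by field.
have r2 : Num.sqrt (Re c ^+ 2 + Im c ^+ 2) ^+ 2 = Re c ^+ 2 + Im c ^+ 2.
  by rewrite sqr_sqrtr// ltW.
have q2 : Im (csqrt c) ^+ 2 = (Num.sqrt (Re c ^+ 2 + Im c ^+ 2) - Re c) / 2.
  have e : 4 * Re (csqrt c) ^+ 2 * Im (csqrt c) ^+ 2 =
      Num.sqrt (Re c ^+ 2 + Im c ^+ 2) ^+ 2 - Re c ^+ 2.
    by rewrite r2 [in RHS]q1; ring.
  have p4 : 4 * Re (csqrt c) ^+ 2 != 0.
    by rewrite mulf_neq0// sqrf_eq0.
  by apply: (mulfI p4); rewrite e p2; field.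
by split=> //; rewrite p2 q2; field.
Qed.

Lemma sqr_csqrt c : slit c -> csqrt c * csqrt c = c.
Proof.
move=> sc; have [h1 h2 _] := csqrt_re_im sc.
apply: complex_eq; rewrite ?cReM ?cImM ?[RHS]h1 ?[RHS]h2;
  move: (Re (csqrt c)) (Im (csqrt c)) => p q; ring.
Qed.

Lemma csqrt_neq0 c : slit c -> csqrt c != 0.
Proof.
by move=> /csqrt_re_gt0 h; apply: contraTneq h => ->; rewrite /= ltxx.
Qed.

Lemma continuous_at_sqrt (f : plane R -> R) z : continuous_at z f ->
  continuous_at z (fun w => Num.sqrt (f w)).
Proof.
move=> cf.
exact: (@cvg_comp _ _ _ f (@Num.sqrt R) _ _ _ cf (@sqrt_continuous R _)).
Qed.

Lemma continuous_csqrt_re (f g : plane R -> R) z :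
  continuous_at z f -> continuous_at z g ->
  continuous_at z (fun w => csqrt_re (f w) (g w)).
Proof.
move=> cf cg; rewrite /csqrt_re.
apply: continuous_at_sqrt.
apply: cvgM; last exact: cvg_cst.
apply: cvgD => //.
apply: continuous_at_sqrt.
under eq_fun do rewrite !expr2.
exact: (continuousD (continuousM cf cf) (continuousM cg cg)).
Qed.

Lemma ccontinuous_csqrt F z : slit (F z) -> ccontinuous F z ->
  ccontinuous (fun w => csqrt (F w)) z.
Proof.
move=> sF [F1 F2]; have h := continuous_csqrt_re F1 F2.
have p0 := csqrt_re_gt0 sF; split; first exact: h.
apply: cvgM; first exact: F2.
apply: cvgV; first by rewrite mulf_neq0// gt_eqF.
by apply: cvgM; [exact: cvg_cst|exact: h].
Qed.

(** The Jacobian of the explicit formula for the root is computed from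
[p = sqrt ((|F| + Re F) / 2)] and [q = Im F / (2 p)], then rewritten in terms of [p]
and [q] by [csqrt_re_im]. *)
Lemma holomorphic_at_csqrt F z c : slit (F z) -> holomorphic_at F z c ->
  holomorphic_at (fun w => csqrt (F w)) z (c * (2 * csqrt (F z))^-1).
Proof.
move=> sF hF v hv; have [F1 F2] := hF v hv.
have [n0 h0] := modulus_gt sF; have p0 := csqrt_re_gt0 sF.
have [Ea Eb Er] := csqrt_re_im sF.
pose s w := Re (F w) * Re (F w) + Im (F w) * Im (F w).
have sE w : s w = Re (F w) ^+ 2 + Im (F w) ^+ 2 by rewrite !expr2.
have ds : is_derive z v s _ :=
  is_deriveD (is_deriveM F1 F1) (is_deriveM F2 F2).
have s0 : 0 < s z by rewrite sE.
have dr := is_derive_comp1 (is_derive1_sqrt s0) ds.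
pose t w := 2^-1 * (Num.sqrt (s w) + Re (F w)).
have tE w : t w = (Num.sqrt (Re (F w) ^+ 2 + Im (F w) ^+ 2) + Re (F w)) / 2.
  by rewrite /t sE mulrC.
have dt : is_derive z v t _ := is_deriveZ (2^-1) (is_deriveD dr F1).
have t0 : 0 < t z by rewrite tE.
have dp := is_derive_comp1 (is_derive1_sqrt t0) dt.
have pE w : Re (csqrt (F w)) = Num.sqrt (t w) by rewrite tE.
set p := Re (csqrt (F z)) in p0 Ea Eb Er.
set q := Im (csqrt (F z)) in Ea Eb Er.
have ptz : Num.sqrt (t z) = p by rewrite -pE.
have rz : Num.sqrt (s z) = p ^+ 2 + q ^+ 2 by rewrite sE Er.
have pn : p != 0 by rewrite gt_eqF.
have rn : p ^+ 2 + q ^+ 2 != 0 by rewrite -rz gt_eqF// sqrtr_gt0.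
have e2 : 2 * csqrt (F z) = Complex (2 * p) (2 * q).
  have -> : csqrt (F z) = Complex p q by exact: complex_eq.
  have -> : 2 = Complex 2 0 :> R[i] by apply: complex_eq => /=; rewrite ?addr0.
  by apply: complex_eq; rewrite ?cReM ?cImM /=; ring.
have n4 : (2 * p) ^+ 2 + (2 * q) ^+ 2 != 0.
  have -> : (2 * p) ^+ 2 + (2 * q) ^+ 2 = 4 * (p ^+ 2 + q ^+ 2) by ring.
  by rewrite mulf_neq0 ?pnatr_eq0.
have reV : Re (2 * csqrt (F z))^-1 = p / (2 * (p ^+ 2 + q ^+ 2)).
  rewrite e2 cReV /=.
  by move: (p) (q) n4 rn => x y n4' yn; field; rewrite n4' yn.
have imV : Im (2 * csqrt (F z))^-1 = - q / (2 * (p ^+ 2 + q ^+ 2)).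
  rewrite e2 cImV /=.
  by move: (p) (q) n4 rn => x y n4' yn; field; rewrite n4' yn.
have dp' : is_derive z v (fun w => Re (csqrt (F w)))
    (Re (toC v * (c * (2 * csqrt (F z))^-1))).
  under eq_fun do rewrite pE.
  apply: (is_derive_eq dp).
  rewrite ptz rz Ea Eb !(cReM, cImM) reV imV.
  move: (Re (toC v)) (Im (toC v)) (Re c) (Im c) => v1 v2 c1 c2.
  by move: (p) (q) pn rn => x y xn yn; rewrite /GRing.scale/=; field; rewrite yn xn.
split=> //.
have d2 := is_derive_comp1 (is_derive1_inv pn) dp'.
have -> : (fun w => Im (csqrt (F w))) =
    2^-1 \*: ((fun w => Im (F w)) * (fun w => (Re (csqrt (F w)))^-1)).
  by apply/funext => w; rewrite /= /GRing.scale/= invfM mulrCA.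
apply: (is_derive_eq (is_deriveZ (2^-1) (is_deriveM F2 d2))).
rewrite -/p Eb !(cReM, cImM) reV imV.
move: (Re (toC v)) (Im (toC v)) (Re c) (Im c) => v1 v2 c1 c2.
by move: (p) (q) pn rn => x y xn yn; rewrite /GRing.scale/=; field; rewrite yn xn.
Qed.

Lemma slit_near F z : ccontinuous F z -> slit (F z) ->
  \forall w \near z, slit (F w).
Proof.
move=> [F1 F2] [h|h].
  by move/cvgr_gt : F1 => /(_ _ h); apply: filterS => w; left.
have h2 : 0 < Im (F z) * Im (F z) by rewrite -expr2 lt_def sqr_ge0 sqrf_eq0 h.
have := continuousM F2 F2 => /cvgr_gt /(_ _ h2); apply: filterS => w /=.
by move=> hw; right; apply: contraTneq hw => ->; rewrite mul0r ltxx.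
Qed.

Lemma smooth_csqrt k F z : slit (F z) -> smooth k F z ->
  smooth k (fun w => csqrt (F w)) z.
Proof.
move=> sF; elim: k F sF => [|k IH] F sF.
  by move=> [cF _]; split=> //; exact: ccontinuous_csqrt.
move=> /[dup] /smoothS sF' [cF [F' [F1 F2]]].
split; first exact: ccontinuous_csqrt.
exists (fun w => F' w * (2 * csqrt (F w))^-1); split.
  have Fw := slit_near cF sF.
  by near do apply: holomorphic_at_csqrt.
apply: smoothM => //; apply: smoothV.
  by rewrite mulf_neq0 ?csqrt_neq0// pnatr_eq0.
by apply: smoothM; [exact: smooth_cst|exact: IH].
Unshelve. all: by end_near. Qed.

End square_root.

Section harmonic.
Context {R : realType}.

(** Along [v] and then [w], the second derivative of [Re F] is [Re (v w F'')], and
[1 ^ 2 + 'i ^ 2 = 0]. *)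
Lemma smooth_harmonic (U : set (plane R)) (F : plane R -> R[i]) :
  (forall z, U z -> smooth 2 F z) ->
  harmonic_on U (fun z => complex.Re (F z)).
Proof.
move=> sF z Uz; have [cF [G [FG [cG [H [GH [cH _]]]]]]] := sF _ Uz.
pose u w := complex.Re (F w).
have D1 v : coord_vectors v ->
    \forall w \near z, 'D_v u w = complex.Re (toC v * G w).
  move=> hv; apply: filterS FG => w Fw.
  by have [[_ ->] _] := Fw v hv.
have dG v w y d : coord_vectors w -> holomorphic_at G y d ->
    is_derive y w (fun x => complex.Re (toC v * G x))
      (complex.Re (toC v * (toC w * d))).
  move=> hw Gy; have [h _] := holomorphic_atM (holomorphic_at_cst (toC v) y) Gy hw.
  by apply: (is_derive_eq h); rewrite mul0r add0r mulrCA.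
have D2 v w : coord_vectors v -> coord_vectors w ->
    \forall y \near z, is_derive y w ('D_v u) (complex.Re (toC v * (toC w * H y))).
  move=> hv hw; have := D1 v hv => /near_join/= D1v.
  near=> y; apply: (@near_eq_is_derive _ _ _ (fun x => complex.Re (toC v * G x))).
    have : \forall x \near y, 'D_v u x = complex.Re (toC v * G x) by near: y.
    by apply: filterS => x ->.
  by apply: dG => //; near: y.
split=> [v w hv hw|].
  split.
  - by have [[]] := nbhs_singleton FG v hv.
  - by have [] := nbhs_singleton (D2 v w hv hw).
  - have e : \forall y \near z,
        complex.Re (toC v * (toC w * H y)) = 'D_w ('D_v u) y.
      by apply: filterS (D2 v w hv hw) => y [_ ->].
    have c := ccontinuousM (ccontinuous_cst (toC v) z)
      (ccontinuousM (ccontinuous_cst (toC w) z) cH).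
    rewrite /prop_for /continuous_at -(nbhs_singleton e).
    exact: (cvg_trans (near_eq_cvg e) c.1).
have h v : coord_vectors v ->
    'D_v ('D_v u) z = complex.Re (toC v * (toC v * H z)).
  by move=> hv; have [_ ->] := nbhs_singleton (D2 v v hv hv).
rewrite !h; [|by right|by left].
rewrite !mulrA -raddfD -mulrDl.
have -> : toC (1, 0) * toC (1, 0) + toC (0, 1) * toC (0, 1) = 0 :> R[i].
  by apply: complex_eq; rewrite ?(cReD, cImD, cReM, cImM) /=; ring.
by rewrite mul0r.
Unshelve. all: by end_near. Qed.

End harmonic.

(** * The complement of a segment in the sphere *)

Section complement_of_segment.
Context {R : realType}.
Implicit Types (z c : plane R).

(** A union of segments with a common endpoint. *)
Lemma star_connected (S : set (plane R)) c :
  (forall z t, S z -> 0 <= t <= 1 -> S (c + t *: (z - c))) -> connected S.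
Proof.
move=> star; have [[z0 Sz0]|S0] := pselect (exists z, S z); last first.
  rewrite (_ : S = set0); first exact: connected0.
  by apply/seteqP; split => // z Sz; exfalso; apply: S0; exists z.
pose A z := (fun t : R => c + t *: (z - c)) @` `[0, 1]%classic.
have -> : S = \bigcup_(z in S) A z.
  apply/seteqP; split => [z Sz|z [y Sy [t]]].
    exists z => //; exists 1; first by rewrite /= in_itv/= lexx ler01.
    by rewrite scale1r addrC subrK.
  by rewrite /= in_itv/= => ht <-; exact: star.
apply: bigcup_connected.
  exists c => z Sz; exists 0; first by rewrite /= in_itv/= lexx ler01.
  by rewrite scale0r addr0.
move=> z _; apply: connected_continuous_connected.
  exact: segment_connected.
apply: continuous_subspaceT => t.
apply: cvgD; first exact: cvg_cst.
by apply: cvgZr_tmp; exact: cvg_id.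
Qed.

Variables a b : R.
Hypothesis ab : a < b.
Let K : set (plane R) := segment a b.

(** The complement is the union of two overlapping star-shaped sets: the planes slit
along the half-lines that extend the segment to the left and to the right. *)
Lemma segmentC_connected : connected (~` K).
Proof.
pose S1 : set (plane R) := [set z | z.2 != 0 \/ b < z.1].
pose S2 : set (plane R) := [set z | z.2 != 0 \/ z.1 < a].
have -> : ~` K = S1 `|` S2.
  apply/seteqP; split => [z nK|z].
    have [z2|z2] := eqVneq z.2 0; last by left; left.
    have [bz|zb] := ltP b z.1; first by left; right.
    have [za|az] := ltP z.1 a; first by right; right.
    by exfalso; apply: nK; split=> //; rewrite az zb.
  move=> [[z2|bz]|[z2|za]] [/andP[az zb] z0].
  - by rewrite z0 eqxx in z2.
  - by rewrite leNgt bz in zb.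
  - by rewrite z0 eqxx in z2.
  - by rewrite leNgt za in az.
apply: connectedU.
- by exists (0, 1); split; left; rewrite /= oner_eq0.
- apply: (@star_connected _ (b + 1, 0)) => z t Sz /andP[t0 t1].
  rewrite /S1 /=; have [->|tn] := eqVneq t 0.
    by right; rewrite scale0r addr0 ltrDl.
  have {}t0 : 0 < t by rewrite lt_def tn.
  case: Sz => [z2|bz]; first by left; rewrite add0r subr0 mulf_neq0.
  by right; rewrite /GRing.scale/=; nra.
- apply: (@star_connected _ (a - 1, 0)) => z t Sz /andP[t0 t1].
  rewrite /S2 /=; have [->|tn] := eqVneq t 0.
    by right; rewrite scale0r addr0 ltrBlDr ltrDl.
  have {}t0 : 0 < t by rewrite lt_def tn.
  case: Sz => [z2|bz]; first by left; rewrite add0r subr0 mulf_neq0.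
  by right; rewrite /GRing.scale/=; nra.
Qed.

Variable y : plane R.
Hypothesis yK : ~ K y.

(** The finite points of the component determine its finite boundary, so it is enough
that the complement is connected in the plane. *)
Lemma component_segmentC (z : plane R) : component y K (Some z) <-> ~ K z.
Proof.
split.
  by move=> /connected_component_sub/= h Kz; apply: h; exists z.
move=> nKz; exists (Some @` (~` K)); last by exists z.
split; first by exists y.
  by move=> _ [w nKw <-] [v Kv [vw]]; apply: nKw; rewrite -vw.
apply: connected_continuous_connected; first exact: segmentC_connected.
apply: continuous_subspaceT.
exact: (@one_point_compactification_some_continuous (plane R)).
Qed.

Lemma boundary_component : boundary (component y K) = K.
Proof.
apply/seteqP; split => z.
  by move=> [_ h]; apply: contrapT => nKz; apply: h; exact/component_segmentC.
move=> Kz; split; last by move/component_segmentC.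
move=> B Bz.
have : \forall w \near z, B (Some w).
  exact: (@one_point_compactification_some_continuous (plane R) z).
move=> /nbhs_ballP[e /= e0 eB].
exists (Some (z.1, z.2 + e / 2)); split.
  apply/component_segmentC => -[_ /=]; case: Kz => _ -> /eqP.
  by rewrite add0r mulf_eq0 invr_eq0 pnatr_eq0 orbF gt_eqF.
apply: eB; split => /=; first exact: ballxx.
rewrite /ball /= opprD addrA subrr sub0r normrN gtr0_norm ?divr_gt0//.
by rewrite ltr_pdivrMr// ltr_pMr// ltr1n.
Qed.

End complement_of_segment.

Section capacity_empty.
Context {R : realType}.

Lemma capacity0 : capacity (set0 : set (plane R)) = 0%E.
Proof.
have c0 : capacity_compact (set0 : set (plane R)) = 0%E.
  rewrite /capacity_compact (_ : [set energy mu | mu in supported set0] = set0).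
    by rewrite ereal_inf0/=.
  apply/seteqP; split => // x [mu]; rewrite /supported setC0 => h _.
  by have := probability_setT mu; rewrite h => /eqP; rewrite eq_sym onee_eq0.
rewrite /capacity (_ : [set capacity_compact K | K in _] = [set 0%E]).
  exact: ereal_sup1.
apply/seteqP; split => [x [K [_ K0] <-]|_ ->].
  by move: K0; rewrite subset0 => ->.
by exists set0 => //; split=> //; exact: compact0.
Qed.

End capacity_empty.

(** * The inverse Joukowski map *)

Section square_modulus.
Context {R : realType}.
Implicit Types (x y : R[i]).
Local Notation Re := (@complex.Re R).
Local Notation Im := (@complex.Im R).

Definition sqm x : R := Re x ^+ 2 + Im x ^+ 2.

Lemma sqm_ge0 x : 0 <= sqm x.
Proof. by rewrite addr_ge0 ?sqr_ge0. Qed.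

Lemma sqmM x y : sqm (x * y) = sqm x * sqm y.
Proof. by rewrite /sqm cReM cImM; ring. Qed.

Lemma sqm1 : sqm 1 = 1.
Proof. by rewrite /sqm /= expr1n expr0n addr0. Qed.

Lemma sqmX x n : sqm (x ^+ n) = sqm x ^+ n.
Proof.
by elim: n => [|n IH]; rewrite ?expr0 ?sqm1// !exprS sqmM IH.
Qed.

Lemma sqm_gt0 x : x != 0 -> 0 < sqm x.
Proof. exact: sq_modulus_gt0. Qed.

Lemma sqmV x : sqm x^-1 = (sqm x)^-1.
Proof.
have [->|x0] := eqVneq x 0; first by rewrite invr0 /sqm /= expr0n addr0 invr0.
apply: (mulfI (lt0r_neq0 (sqm_gt0 x0))).
by rewrite -sqmM !mulfV ?sqm1// gt_eqF// sqm_gt0.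
Qed.

Lemma sqm_parallelogram x y : sqm (x + y) + sqm (x - y) = 2 * (sqm x + sqm y).
Proof. by rewrite /sqm !(cReD, cImD, cReN, cImN) /=; ring. Qed.

Lemma normr_Re_le1 x : sqm x <= 1 -> `|Re x| <= 1.
Proof.
move=> h; rewrite -sqrtr_sqr -sqrtr1 ler_wsqrtr// (le_trans _ h)//.
by rewrite lerDl sqr_ge0.
Qed.

End square_modulus.

Section inverse_joukowski.
Context {R : realType}.
Local Notation Re := (@complex.Re R).
Local Notation Im := (@complex.Im R).

(** For [W = 1 / Z] this is the root [x] of [x + 1 / x = 2 Z] inside the unit disc. In
terms of [W] the formula is regular at [W = 0], that is at [Z] infinite. *)
Definition joukowski_inv (W : R[i]) : R[i] := W / (1 + csqrt (1 - W * W)).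

Section joukowski_inv.
Variable W : R[i].
Hypothesis sW : slit (1 - W * W).

Lemma one_add_csqrt_neq0 : 1 + csqrt (1 - W * W) != 0.
Proof.
apply/eqP => /(congr1 Re); rewrite cReD => /eqP; rewrite gt_eqF//.
by rewrite addr_gt0//= ?ltr01//; exact: csqrt_re_gt0.
Qed.

Lemma joukowski_inv_sum : W != 0 -> joukowski_inv W + (joukowski_inv W)^-1 = 2 * W^-1.
Proof.
move=> W0; have d0 := one_add_csqrt_neq0.
have S2 := sqr_csqrt sW.
rewrite /joukowski_inv; move: (csqrt _) d0 S2 => S d0 S2.
have : (W * W + (1 + S) * (1 + S)) = 2 * (1 + S).
  have -> : W * W = 1 - S * S by rewrite S2; ring.
  by ring.
move=> e; rewrite invfM invrK.
have -> : W / (1 + S) + W^-1 * (1 + S) =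
    (W * W + (1 + S) * (1 + S)) / (W * (1 + S)) by field; rewrite W0 d0.
by rewrite e; field; rewrite W0 d0.
Qed.

(** With [S] the square root, [W ^ 2 = (1 - S) (1 + S)], and [1 - S] is shorter than
[1 + S] because [S] has positive real part. *)
Lemma sqm_joukowski_inv_lt1 : sqm (joukowski_inv W) < 1.
Proof.
have p0 := csqrt_re_gt0 sW; have S2 := sqr_csqrt sW.
have d0 := one_add_csqrt_neq0.
rewrite /joukowski_inv sqmM sqmV; move: (csqrt _) p0 d0 S2 => S p0 d0 S2.
rewrite ltr_pdivrMr ?sqm_gt0// mul1r.
have e : sqm W ^+ 2 = sqm (1 - S) * sqm (1 + S).
  rewrite expr2 -!sqmM; congr sqm.
  have -> : W * W = 1 - S * S by rewrite S2; ring.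
  by ring.
(* The difference of the two sides is four times the real part of [S]. *)
have lt : sqm (1 - S) < sqm (1 + S).
  rewrite /sqm !(cReD, cImD, cReN, cImN) /=.
  by nra.
rewrite -(@ltr_pXn2r _ 2) ?nnegrE ?sqm_ge0// e [in ltRHS]expr2 ltr_pM2r//.
by rewrite sqm_gt0.
Qed.

Lemma joukowski_inv_real : Im W = 0 -> Im (joukowski_inv W) = 0.
Proof.
move=> W0; have c0 : Im (1 - W * W) = 0.
  by rewrite cImD cImN cImM W0 mulr0 mul0r addr0 oppr0 addr0.
have i0 : Im (1 + csqrt (1 - W * W)) = 0.
  by rewrite cImD [Im (csqrt _)]/= c0 mul0r addr0.
by rewrite /joukowski_inv cImM cImV i0 W0 oppr0 mul0r mulr0 mul0r addr0.
Qed.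

End joukowski_inv.

(** The complex form of [T_n (cos t) = cos (n t)]. *)
Lemma chebT_joukowski n (Z x : R[i]) : x != 0 -> x + x^-1 = 2 * Z ->
  2 * chebT n Z = x ^+ n + x^-1 ^+ n.
Proof.
move=> x0 e; suff: 2 * chebT n Z = x ^+ n + x^-1 ^+ n /\
  2 * chebT n.+1 Z = x ^+ n.+1 + x^-1 ^+ n.+1 by case.
elim: n => [|n [IH0 IH1]].
  by rewrite chebT0 chebT1 !expr0 !expr1 e mulr1.
split=> //; rewrite chebTSS mulrBr IH0 mulrCA IH1 -e.
have h1 k : x^-1 * x ^+ k.+1 = x ^+ k by rewrite exprS mulKf.
have h2 k : x * x^-1 ^+ k.+1 = x^-1 ^+ k by rewrite exprS mulVKf.
rewrite mulrDl !mulrDr h1 h2 -!exprS; ring.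
Qed.

(** [x^-1 ^+ n] is the conjugate of [x ^+ n] divided by its square modulus, so its real
part is proportional to that of [x ^+ n]. *)
Lemma Re_pow_joukowski n (Z x : R[i]) : x != 0 -> x + x^-1 = 2 * Z ->
  Re (x ^+ n) = 2 * Re (chebT n Z) * (sqm x ^+ n / (1 + sqm x ^+ n)).
Proof.
move=> x0 e; have := congr1 Re (chebT_joukowski n x0 e).
rewrite exprVn cReD cReV -/(sqm (x ^+ n)) sqmX cReM.
have -> : Re (2 : R[i]) = 2 by [].
have -> : Im (2 : R[i]) = 0 by rewrite /= addr0.
rewrite mul0r subr0 => ->.
have p : 0 < sqm x ^+ n by rewrite exprn_gt0// sqm_gt0.
by field; rewrite !gt_eqF// addr_gt0.
Qed.

(** The level lines of [|x|] are ellipses with foci [-1] and [1]: by the parallelogram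
identity applied to [Z = (x + 1 / x) / 2] and to [(x - 1 / x) / 2], whose square is
[Z ^ 2 - 1], the number [B] equals [(|x|^2 + |x|^-2) / 2]. *)
Lemma sqm_from_joukowski (Z x : R[i]) : x != 0 -> x + x^-1 = 2 * Z -> sqm x <= 1 ->
  let B := sqm Z + Num.sqrt (sqm (Z * Z - 1)) in
  sqm x = B - Num.sqrt (B ^+ 2 - 1).
Proof.
move=> x0 e x1 B; have p := sqm_gt0 x0.
have eD : Z * Z - 1 = ((x - x^-1) / 2) * ((x - x^-1) / 2).
  have -> : Z = (x + x^-1) / 2 by rewrite e mulrC mulKf// pnatr_eq0.
  by field; rewrite x0.
have eB : B = (sqm x + (sqm x)^-1) / 2.
  rewrite /B eD sqmM -expr2 sqrtr_sqr ger0_norm ?sqm_ge0//.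
  have -> : Z = (x + x^-1) / 2 by rewrite e mulrC mulKf// pnatr_eq0.
  rewrite !sqmM -mulrDl sqm_parallelogram !sqmV.
  have -> : sqm (2 : R[i]) = 4 by rewrite /sqm /=; ring.
  by field; rewrite gt_eqF.
have -> : B ^+ 2 - 1 = (((sqm x)^-1 - sqm x) / 2) ^+ 2.
  by rewrite eB; field; rewrite gt_eqF.
rewrite sqrtr_sqr ger0_norm; first by rewrite eB; field; rewrite gt_eqF.
by rewrite divr_ge0// subr_ge0 (le_trans x1)// -[leLHS]invr1 lef_pV2 ?posrE.
Qed.

End inverse_joukowski.

(** * Harmonic measure of the complement of a segment *)

Section dirichlet.
Context {R : realType}.
Local Notation Re := (@complex.Re R).
Local Notation Im := (@complex.Im R).
Variables a b : R.
Hypothesis ab : a < b.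
Let K : set (plane R) := segment a b.
Let mid : R := (a + b) / 2.
Let half : R := (b - a) / 2.

Let half_gt0 : 0 < half := half_length_gt0 ab.

Definition cmid : R[i] := Complex ((a + b) / 2) 0.
Definition chalf : R[i] := Complex ((b - a) / 2) 0.

(** The inverse of the affine coordinate in which the segment is [[-1, 1]]. *)
Definition inverse_coord (z : plane R) : R[i] := chalf / (toC z - cmid).

Lemma chalf_neq0 : chalf != 0.
Proof. by rewrite eq_complex /= eqxx andbT gt_eqF// half_gt0. Qed.

Lemma inverse_coord_neq0 z : ~ K z -> inverse_coord z != 0.
Proof.
move=> nKz; rewrite mulf_neq0 ?chalf_neq0// invr_neq0//.
apply/eqP => h; apply: nKz.
have h1 : z.1 - mid = 0 by have := congr1 Re h; rewrite cReD cReN.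
have h2 : z.2 = 0 by have := congr1 Im h; rewrite cImD cImN oppr0 addr0.
have := half_gt0; rewrite /half => h0.
split=> //; move: h1; rewrite /mid => h1; apply/andP; split; lra.
Qed.

(** [1 - W^2] is real and nonpositive only if [W] is real of modulus at least 1, that is
[1 / W] in [[-1, 1]]. *)
Lemma inverse_coord_slit z : ~ K z -> slit (1 - inverse_coord z * inverse_coord z).
Proof.
move=> nKz; have h0 := half_gt0.
set W := inverse_coord z.
pose X := z.1 - mid; pose Y := z.2.
have rX : Re (toC z - cmid) = X by rewrite cReD cReN.
have iX : Im (toC z - cmid) = Y by rewrite cImD cImN oppr0 addr0.
have rW : Re W = half * X / (X ^+ 2 + Y ^+ 2).
  by rewrite /W /inverse_coord cReM cReV cImV rX iX /= mul0r subr0 mulrA.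
have iW : Im W = - (half * Y / (X ^+ 2 + Y ^+ 2)).
  rewrite /W /inverse_coord cImM cReV cImV rX iX /= mul0r addr0.
  by rewrite mulNr mulrN mulrA.
have rS : Re (1 - W * W) = 1 - Re W ^+ 2 + Im W ^+ 2.
  by rewrite cReD cReN cReM [Re 1]/=; move: (Re W) (Im W) => u v; ring.
have iS : Im (1 - W * W) = - (2 * Re W * Im W).
  by rewrite cImD cImN cImM [Im 1]/=; move: (Re W) (Im W) => u v; ring.
have [Y0|Yn] := eqVneq Y 0.
  left; rewrite rS iW rW Y0 !(mulr0, mul0r, oppr0) expr0n/= !addr0 subr_gt0.
  have hX : half ^+ 2 < X ^+ 2.
    have hX : half < `|X|.
      rewrite ltNge; apply/negP => hX; apply: nKz; split=> //.
      by move: hX; rewrite ler_norml /X /half /mid => /andP[? ?]; apply/andP; split; lra.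
    by rewrite -[X ^+ 2]real_normK ?num_real// ltr_pXn2r ?nnegrE// ltW.
  have X0 : 0 < X ^+ 2 by apply: le_lt_trans hX; exact: sqr_ge0.
  have -> : (half * X / X ^+ 2) ^+ 2 = half ^+ 2 / X ^+ 2.
    by field; rewrite -sqrf_eq0 gt_eqF.
  by rewrite ltr_pdivrMr// mul1r.
have [X0|Xn] := eqVneq X 0.
  left; rewrite rS rW X0 mulr0 mul0r expr0n/= subr0.
  by rewrite ltr_pwDl ?sqr_ge0.
have q0 : X ^+ 2 + Y ^+ 2 != 0.
  by rewrite gt_eqF// ltr_wpDl ?sqr_ge0// lt_def sqr_ge0 sqrf_eq0 Yn.
have ban : b - a != 0 by rewrite subr_eq0 gt_eqF.
by right; rewrite iS oppr_eq0 iW rW mulrN oppr_eq0 !mulf_neq0 ?invr_neq0 ?pnatr_eq0.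
Qed.

(** The conformal map from the complement of the segment to the unit disc, with the
point at infinity going to 0. *)
Definition exterior_map (x : sphere R) : R[i] :=
  if x is Some z then joukowski_inv (inverse_coord z) else 0.

Lemma smooth_joukowski_inv k (W : plane R -> R[i]) z : smooth k W z ->
  slit (1 - W z * W z) -> smooth k (fun w => joukowski_inv (W w)) z.
Proof.
move=> sW slW; apply: smoothM => //; apply: smoothV.
  exact: one_add_csqrt_neq0.
apply: smoothD; first exact: smooth_cst.
apply: smooth_csqrt => //; apply: smoothD; first exact: smooth_cst.
have -> : (fun w => - (W w * W w)) = (fun w => -1 * (W w * W w)).
  by apply/funext => w; rewrite mulN1r.
by apply: smoothM; [exact: smooth_cst|exact: smoothM].
Qed.

Lemma smooth_exterior_map k z : ~ K z -> smooth k (fun w => exterior_map (Some w)) z.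
Proof.
move=> nKz; apply: smooth_joukowski_inv; last exact: inverse_coord_slit.
apply: smoothM; first exact: smooth_cst.
apply: smoothV; last by apply: smoothD; [exact: smooth_toC|exact: smooth_cst].
by have := inverse_coord_neq0 nKz; rewrite mulf_eq0 negb_or invr_eq0 => /andP[].
Qed.

Lemma toC_ofC (x : R[i]) : toC (ofC x) = x.
Proof. by case: x. Qed.

Lemma toC_eq0 (w : plane R) : (toC w == 0) = (w == 0).
Proof. by case: w => x y; rewrite eq_complex. Qed.

(** [inverse_coord] at [1 / w], written so that it is regular at [w = 0]. *)
Definition chart_coord (w : plane R) : R[i] :=
  chalf * (toC w * (1 - cmid * toC w)^-1).

Lemma exterior_map_chart w : exterior_map (chart_infty w) = joukowski_inv (chart_coord w).
Proof.
rewrite /chart_infty; have [->|w0] := eqVneq w 0.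
  by rewrite /exterior_map /chart_coord /joukowski_inv (_ : toC 0 = 0)// mul0r mulr0 mul0r.
have c0 : toC w != 0 by rewrite toC_eq0.
rewrite /exterior_map /inverse_coord toC_ofC /chart_coord; congr (joukowski_inv (_ * _)).
have -> : (toC w)^-1 - cmid = (1 - cmid * toC w) / toC w.
  by rewrite mulrBl mul1r mulfK.
by rewrite invfM invrK mulrC.
Qed.

Lemma chart_coord_good w : (forall z, chart_infty w = Some z -> ~ K z) ->
  1 - cmid * toC w != 0 /\ slit (1 - chart_coord w * chart_coord w).
Proof.
rewrite /chart_infty; have [-> _|w0 h] := eqVneq w 0.
  rewrite (_ : toC 0 = 0)// mulr0 subr0 oner_eq0; split=> //.
  rewrite /chart_coord (_ : toC 0 = 0)// mul0r !mulr0 subr0.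
  by left; rewrite /= ltr01.
have nK := h _ erefl; have c0 : toC w != 0 by rewrite toC_eq0.
have e : chart_coord w = inverse_coord (ofC (toC w)^-1).
  rewrite /inverse_coord toC_ofC /chart_coord; congr (_ * _).
  have -> : (toC w)^-1 - cmid = (1 - cmid * toC w) / toC w.
    by rewrite mulrBl mul1r mulfK.
  by rewrite invfM invrK mulrC.
split; last by rewrite e; exact: inverse_coord_slit.
have := inverse_coord_neq0 nK; rewrite -e /chart_coord.
by rewrite !mulf_eq0 !negb_or invr_eq0 => /andP[_ /andP[]].
Qed.

Lemma smooth_exterior_map_chart k w : (forall z, chart_infty w = Some z -> ~ K z) ->
  smooth k (fun y => exterior_map (chart_infty y)) w.
Proof.
move=> /chart_coord_good[d0 sl]; under eq_fun do rewrite exterior_map_chart.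
apply: smooth_joukowski_inv => //; apply: smoothM; first exact: smooth_cst.
apply: smoothM; first exact: smooth_toC.
apply: smoothV => //; apply: smoothD; first exact: smooth_cst.
have -> : (fun w => - (cmid * toC w)) = (fun w => (- cmid) * toC w).
  by apply/funext => v; rewrite mulNr.
by apply: smoothM; [exact: smooth_cst|exact: smooth_toC].
Qed.

Lemma sqm_exterior_map_le1 x : (forall z, x = Some z -> ~ K z) -> sqm (exterior_map x) <= 1.
Proof.
case: x => [z|] h /=; last by rewrite /sqm /= expr0n addr0.
by apply/ltW/sqm_joukowski_inv_lt1/inverse_coord_slit; exact: h.
Qed.

Lemma exterior_map_neq0 z : ~ K z -> exterior_map (Some z) != 0.
Proof.
move=> nKz; rewrite mulf_neq0 ?inverse_coord_neq0// invr_neq0//.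
by apply: one_add_csqrt_neq0; exact: inverse_coord_slit.
Qed.

(** The complex extension of [ncoord]. *)
Definition ccoord (z : plane R) : R[i] := (toC z - cmid) / chalf.

Lemma exterior_map_joukowski z : ~ K z ->
  exterior_map (Some z) + (exterior_map (Some z))^-1 = 2 * ccoord z.
Proof.
move=> nKz; rewrite /exterior_map joukowski_inv_sum; first by rewrite /inverse_coord invfM invrK [X in 2 * X]mulrC.
  exact: inverse_coord_slit.
exact: inverse_coord_neq0.
Qed.

Definition joukowski_modulus (z : plane R) : R :=
  sqm (ccoord z) + Num.sqrt (sqm (ccoord z * ccoord z - 1)).

Definition inner_radius (z : plane R) : R :=
  joukowski_modulus z - Num.sqrt (joukowski_modulus z ^+ 2 - 1).

(** The right-hand side of [Re_pow_joukowski] with the square modulus expressed by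
[sqm_from_joukowski]. Unlike [exterior_map], all its ingredients are continuous across
the segment, and it agrees with [T_n] there: this yields the boundary values. *)
Definition boundary_extension n z : R :=
  2 * Re (chebT n (ccoord z)) * (inner_radius z ^+ n / (1 + inner_radius z ^+ n)).

Lemma Re_exterior_map_pow n z : ~ K z -> Re (exterior_map (Some z) ^+ n) = boundary_extension n z.
Proof.
move=> nKz; have x0 := exterior_map_neq0 nKz; have e := exterior_map_joukowski nKz.
rewrite (Re_pow_joukowski n x0 e) /boundary_extension /inner_radius /joukowski_modulus.
rewrite -(sqm_from_joukowski x0 e)//.
by apply: sqm_exterior_map_le1 => w [<-].
Qed.

Lemma ccoord_segment z : K z -> ccoord z = Complex (ncoord a b z) 0.
Proof.
have h0 := half_gt0; move=> [_ z0].
apply: (mulIf chalf_neq0); rewrite mulfVK ?chalf_neq0//.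
apply: complex_eq; rewrite ?cReM ?cImM ?cReD ?cImD ?cReN ?cImN /=.
  by rewrite mulr0 subr0 /ncoord mulfVK// gt_eqF.
by rewrite z0 !mulr0 mul0r addr0 subr0.
Qed.

Lemma chebT_real n (x : R) : chebT n (Complex x 0) = Complex (chebT n x) 0 :> R[i].
Proof.
suff: chebT n (Complex x 0) = Complex (chebT n x) 0 :> R[i] /\
      chebT n.+1 (Complex x 0) = Complex (chebT n.+1 x) 0 :> R[i] by case.
elim: n => [|n [IH0 IH1]]; first by split.
split=> //; rewrite !chebTSS IH0 IH1.
by apply: complex_eq; rewrite ?cReD ?cImD ?cReN ?cImN /=; ring.
Qed.

Lemma inner_radius_segment z : K z -> inner_radius z = 1.
Proof.
move=> Kz; have B1 : joukowski_modulus z = 1.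
  rewrite /joukowski_modulus ccoord_segment//.
  have -> : Complex (ncoord a b z) 0 * Complex (ncoord a b z) 0 - 1 =
            Complex (ncoord a b z ^+ 2 - 1) 0 :> R[i].
    by apply: complex_eq; rewrite ?cReD ?cImD ?cReN ?cImN /=; ring.
  rewrite /sqm /= expr0n/= !addr0 sqrtr_sqr ler0_norm; first by ring.
  by have /andP[? ?] := ncoord_in ab Kz; nra.
by rewrite /inner_radius B1 expr1n subrr sqrtr0 subr0.
Qed.

Lemma boundary_extension_segment n z : K z ->
  boundary_extension n z = chebT n (ncoord a b z).
Proof.
move=> Kz; rewrite /boundary_extension inner_radius_segment// ccoord_segment//.
by rewrite chebT_real expr1n /=; field.
Qed.

Lemma ccontinuous_ccoord z : ccontinuous ccoord z.
Proof.
apply: ccontinuousM; last exact: ccontinuous_cst.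
apply: ccontinuousD; last exact: ccontinuous_cst.
exact: (smooth_continuous (smooth_toC 0 z)).
Qed.

Lemma ccontinuous_chebT n (F : plane R -> R[i]) z : ccontinuous F z ->
  ccontinuous (fun w => chebT n (F w)) z.
Proof.
move=> cF; suff: ccontinuous (fun w => chebT n (F w)) z /\
  ccontinuous (fun w => chebT n.+1 (F w)) z by case.
elim: n => [|n [IH0 IH1]]; first by split; [exact: ccontinuous_cst|].
split=> //; under eq_fun do rewrite chebTSS -mulN1r.
apply: ccontinuousD; last by apply: ccontinuousM => //; exact: ccontinuous_cst.
by do 2 (apply: ccontinuousM => //); exact: ccontinuous_cst.
Qed.

Lemma continuous_at_exp (f : plane R -> R) n z : continuous_at z f ->
  continuous_at z (fun w => f w ^+ n).
Proof.
move=> cf; exact: (@cvg_comp _ _ _ f (fun y : R => y ^+ n) _ _ _ cf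
  (@exprn_continuous R n _)).
Qed.

Lemma continuous_boundary_extension n z : K z ->
  continuous_at z (boundary_extension n).
Proof.
move=> Kz; have cc := ccontinuous_ccoord z.
have cB : continuous_at z joukowski_modulus.
  apply: cvgD; first exact: (ccontinuous_sq_modulus cc).
  apply: continuous_at_sqrt.
  apply: (@ccontinuous_sq_modulus _ (fun w => ccoord w * ccoord w - 1)).
  apply: ccontinuousD; last exact: ccontinuous_cst.
  exact: ccontinuousM.
have cr : continuous_at z inner_radius.
  apply: cvgB; first exact: cB.
  apply: continuous_at_sqrt; apply: cvgB; last exact: cvg_cst.
  exact: continuous_at_exp.
have crn := continuous_at_exp (n := n) cr.
have [cT _] := ccontinuous_chebT n cc.
apply: cvgM; first by apply: cvgM; [exact: cvg_cst|exact: cT].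
apply: cvgM; first exact: crn.
apply: cvgV; first by rewrite inner_radius_segment// expr1n pnatr_eq0.
by apply: cvgD; [exact: cvg_cst|exact: crn].
Qed.

Lemma continuous_chebT_ncoord n : continuous (fun z => chebT n (ncoord a b z)).
Proof.
move=> z.
have [h _] : ccontinuous (fun w : plane R => chebT n (Complex (ncoord a b w) 0)) z.
  apply: ccontinuous_chebT; split=> /=; last exact: cvg_cst.
  apply: cvgM; last exact: cvg_cst.
  apply: cvgB; last exact: cvg_cst.
  exact: (smooth_continuous (smooth_toC 0 z)).1.
move: h; rewrite /continuous_at.
by under eq_fun do rewrite chebT_real; rewrite chebT_real.
Qed.

Variable y : plane R.
Hypothesis yK : ~ K y.
Let Omega := component y K.

Let Omega_some z : Omega (Some z) -> ~ K z.
Proof. by move/component_segmentC; apply. Qed.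

Lemma chebT_solves_dirichlet n :
  solves_dirichlet Omega (fun z => chebT n (ncoord a b z))
    (fun x => Re (exterior_map x ^+ n)).
Proof.
split.
- split.
    apply: (@smooth_harmonic R _ (fun z => exterior_map (Some z) ^+ n)) => z /Omega_some nKz.
    by apply: smoothX; exact: smooth_exterior_map.
  apply: (@smooth_harmonic R _ (fun w => exterior_map (chart_infty w) ^+ n)) => w Ow.
  apply: smoothX; apply: smooth_exterior_map_chart => z wz; apply: Omega_some.
  by rewrite -wz.
- exists 1 => x Ox; apply: normr_Re_le1; rewrite sqmX.
  apply: exprn_ile1; first exact: sqm_ge0.
  by apply: sqm_exterior_map_le1 => z xz; apply: Omega_some; rewrite -xz.
- rewrite (_ : [set _ | _] = set0) ?capacity0//.
  apply/seteqP; split => // z [Bz h]; apply: h.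
  have Kz : K z by move: Bz; rewrite boundary_component.
  rewrite /has_boundary_value -boundary_extension_segment//.
  have c := continuous_boundary_extension (n := n) Kz.
  (* Off the segment the solution is [boundary_extension], continuous at [z]. *)
  apply: (cvg_trans _ (cvg_trans (cvg_app _ (@cvg_within _ (nbhs z) _ _)) c)).
  apply: near_eq_cvg; rewrite near_withinE.
  by near=> w; move=> /Omega_some nKw; rewrite -Re_exterior_map_pow.
Unshelve. all: by end_near. Qed.

Lemma harmonic_measure_moments (w : probability (plane R) R) :
  is_harmonic_measure_compact y K w ->
  supported K w /\
  forall n, \int[w]_(z in K) chebT n (ncoord a b z) = Re (exterior_map (Some y) ^+ n).
Proof.
rewrite /is_harmonic_measure_compact /is_harmonic_measure boundary_component//.
move=> [sw hw]; split=> // n; rewrite /Rintegral.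
rewrite (hw _ _ _ (chebT_solves_dirichlet n))//.
by apply: continuous_subspaceT; exact: continuous_chebT_ncoord.
Qed.

(** The parameter is the value of [exterior_map] at the pole, which is real. *)
Lemma harmonic_measure_real_moments (w : probability (plane R) R) :
  y.2 = 0 -> is_harmonic_measure_compact y K w ->
  exists s : R, [/\ supported K w, `|s| < 1 & chebyshev_moments w K (ncoord a b) s].
Proof.
move=> y2 /harmonic_measure_moments[sw hw].
have i0 : Im (exterior_map (Some y)) = 0.
  have e : Im (toC y - cmid) = 0 by rewrite cImD cImN /= y2 oppr0 addr0.
  apply: joukowski_inv_real.
  by rewrite /inverse_coord cImM cImV e oppr0 mul0r mulr0 mul0r addr0.
exists (Re (exterior_map (Some y))); split=> //.
  have := sqm_joukowski_inv_lt1 (inverse_coord_slit yK).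
  rewrite /sqm [Im _]i0 expr0n addr0 => h.
  by rewrite -sqrtr_sqr -sqrtr1 ltr_sqrt.
move=> n; rewrite hw.
elim: n => [|n IH]; first by rewrite !expr0.
by rewrite !exprS cReM IH i0 mul0r subr0.
Qed.

End dirichlet.

(** * The criterion *)

Section combination.
Local Open Scope ereal_scope.
Context d (T : measurableType d) {R : realType}.
Variables (t c : {nonneg R}) (nu : {measure set T -> \bar R})
  (om : {measure set T -> \bar R}^nat) (N : nat).

Definition combination : {measure set T -> \bar R} :=
  measure_add (mscale t nu) (mscale c (msum om N)).

Lemma ge0_integral_combination (f : T -> \bar R) :
  measurable_fun setT f -> (forall x, 0 <= f x) ->
  \int[combination]_x f x =
  t%:num%:E * \int[nu]_x f x + c%:num%:E * \sum_(k < N) \int[om k]_x f x.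
Proof.
move=> mf f0; rewrite ge0_integral_measure_add// !ge0_integral_mscale//.
by rewrite ge0_integral_measure_sum.
Qed.

Variable f : T -> \bar R.
Hypotheses (mf : measurable_fun setT f) (inu : nu.-integrable setT f)
  (iom : forall k, (k < N)%N -> (om k).-integrable setT f).

Lemma ge0_fin_combination (g : T -> \bar R) :
  measurable_fun setT g -> (forall x, 0 <= g x) ->
  nu.-integrable setT g -> (forall k, (k < N)%N -> (om k).-integrable setT g) ->
  \int[combination]_x g x = (t%:num * fine (\int[nu]_x g x) +
     c%:num * \sum_(k < N) fine (\int[om k]_x g x))%:E.
Proof.
move=> mg g0 ig igk; rewrite ge0_integral_combination// EFinD !EFinM.
congr (_ * _ + _ * _); first by rewrite fineK// integrable_fin_num.
rewrite -sumEFin; apply: eq_bigr => k _.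
by rewrite fineK// integrable_fin_num//; exact: igk.
Qed.

Lemma integrable_combination : combination.-integrable setT f.
Proof.
apply/integrableP; split => //.
rewrite ge0_fin_combination ?ltry//.
- exact: measurableT_comp.
- exact: integrable_abse.
- by move=> k kN; apply: integrable_abse => //; exact: iom.
Qed.

Lemma integral_combination :
  \int[combination]_x f x = (t%:num * fine (\int[nu]_x f x) +
     c%:num * \sum_(k < N) fine (\int[om k]_x f x))%:E.
Proof.
have fE (mu : {measure set T -> \bar R}) : mu.-integrable setT f ->
    fine (\int[mu]_x f x) =
    (fine (\int[mu]_x f^\+ x) - fine (\int[mu]_x f^\- x))%R.
  move=> i; rewrite integralE fineB//; apply: integrable_fin_num => //.
  - exact: integrable_funepos.
  - exact: integrable_funeneg.
rewrite integralE !ge0_fin_combination//.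
- rewrite -EFinB; congr EFin; rewrite fE//.
  rewrite [in RHS](eq_bigr (fun k : 'I_N => fine (\int[om k]_x f^\+ x) -
      fine (\int[om k]_x f^\- x)))%R; last by move=> k _; rewrite fE//; exact: iom.
  by rewrite sumrB; ring.
- exact: measurable_funeneg.
- exact: integrable_funeneg.
- by move=> k kN; apply: integrable_funeneg => //; exact: iom.
- exact: measurable_funepos.
- exact: integrable_funepos.
- by move=> k kN; apply: integrable_funepos => //; exact: iom.
Qed.

End combination.

Section logabs_algebra.
Context {R : realType}.

Lemma logabsM (x y : R[i]) : logabs (x * y) = (logabs x + logabs y)%E.
Proof.
have e (z : R[i]) : logabs z = if z == 0 then -oo%E else (ln (complex.Re `|z|))%:E.
  have [->|z0] := eqVneq z 0; first by rewrite /logabs normr0 le0_lneNy.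
  rewrite /logabs lne_EFin// normc_def/= sqrtr_gt0.
  exact: sq_modulus_gt0.
rewrite !e mulf_eq0; have [//|x0] := eqVneq x 0.
have [_|y0] := eqVneq y 0; first by rewrite addeNy.
rewrite normrM cReM -EFinD.
have i (z : R[i]) : complex.Im `|z| = 0 by rewrite normc_def.
have p (z : R[i]) : z != 0 -> 0 < complex.Re `|z|.
  by move=> z0; rewrite normc_def/= sqrtr_gt0; exact: sq_modulus_gt0.
by rewrite !i mulr0 subr0 lnM// posrE p.
Qed.

Lemma logabs_prod (s : seq R[i]) (x : R[i]) :
  logabs (\prod_(r <- s) (x - r)) = (\sum_(r <- s) logabs (x - r)%R)%E.
Proof.
elim: s => [|r s IH]; last by rewrite !big_cons logabsM IH.
by rewrite !big_nil /logabs normr1 /= ler10 ln1.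
Qed.

Lemma logabs_poly (p : {poly R[i]}) : exists s : seq R[i], forall x,
  logabs p.[x] = (logabs (lead_coef p) + \sum_(r <- s) logabs (x - r)%R)%E.
Proof.
have [s ps] := closed_field_poly_normal p; exists s => x.
rewrite [in LHS]ps hornerZ logabsM -logabs_prod; congr (_ + logabs _)%E.
rewrite horner_prod; apply: eq_bigr => r _.
by rewrite hornerXsubC.
Qed.

Lemma logabs_int_ge0 (k : int) : k != 0 -> (0 <= logabs (k%:~R : R[i]))%E.
Proof.
move=> k0; rewrite /logabs lne_ge0 lee_fin.
have -> : `|k%:~R| = (`|k|%:~R : R)%:C%C :> R[i].
  by rewrite -intr_norm rmorph_int.
by rewrite /= ler1z -gtz0_ge1 normr_gt0.
Qed.

(** The nearest point of the segment. *)
Definition segment_proj (a b : R) (x : R[i]) : plane R :=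
  (Num.max a (Num.min b (complex.Re x)), 0).

Lemma segment_proj_in a b x : a <= b -> segment a b (segment_proj a b x).
Proof.
by move=> ab; split=> //=; rewrite le_max lexx/= ge_max ab ge_min lexx.
Qed.

Lemma logabs_proj_le a b x z : a <= b -> segment a b z ->
  (logabs (toC z - toC (segment_proj a b x))%R <= logabs (toC z - x)%R)%E.
Proof.
move=> ab [/andP[az zb] z0].
rewrite !logabsE lee_lne ?in_itv/= ?lee_fin ?leey ?sqrtr_ge0//.
rewrite ler_wsqrtr// lerD//.
  rewrite !cReD !cReN /=; set u := complex.Re x.
  have [bu|ub] := ltP b u.
    by rewrite (max_idPr ab); nra.
  by have [ua|//] := ltP u a; nra.
by rewrite !cImD !cImN /= z0 subr0 expr0n sqr_ge0.
Qed.

End logabs_algebra.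

Section concavity.
Context {R : realType}.

(** Concavity of [ln], at the endpoints [-1] and [1] with weights [(1 - x) / 2] and
[(1 + x) / 2]. *)
Lemma ln_affine_concave (s x : R) : `|s| < 1 -> -1 <= x <= 1 ->
  (1 - x) / 2 * ln (1 - 2 * s * -1 + s ^+ 2) +
  (1 + x) / 2 * ln (1 - 2 * s * 1 + s ^+ 2) <= ln (1 - 2 * s * x + s ^+ 2).
Proof.
move=> s1 /andP[x0 x1]; have n1 : -1 <= 1 :> R by lra.
have p : 0 < 1 - 2 * s * -1 + s ^+ 2.
  by apply: quadratic_gt0 => //; rewrite lexx.
have q : 0 < 1 - 2 * s * 1 + s ^+ 2.
  by apply: quadratic_gt0 => //; rewrite lexx andbT.
have l0 : 0 <= (1 - x) / 2 by lra.
have l1 : (1 - x) / 2 <= 1 by lra.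
have := @concave_ln R (Itv01 l0 l1) _ _ p q; rewrite !convRE /= /unstable.onem.
have -> : 1 - (1 - x) / 2 = (1 + x) / 2 by field.
move=> /le_trans; apply; rewrite le_eqVlt; apply/orP; left; apply/eqP.
by congr ln; field.
Qed.

End concavity.

(** At points of the segment the potential is concave, so its sign at the endpoints
decides; at other points it is at least its value at the nearest point of the
segment. *)
Lemma potential_criterion (R : realType) (a b : R) (ab : a < b)
    (t c : {nonneg R}) (nu : probability (plane R) R)
    (om : nat -> probability (plane R) R) (N : nat) (s : nat -> R)
    (nuK : supported (segment a b) nu)
    (nu0 : chebyshev_moments nu (segment a b) (ncoord a b) 0)
    (omK : forall k, (k < N)%N -> supported (segment a b) (om k))
    (s1 : forall k, (k < N)%N -> `|s k| < 1)
    (oms : forall k, (k < N)%N ->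
       chebyshev_moments (om k) (segment a b) (ncoord a b) (s k)) :
  let mu := combination t c nu (fun k => om k : {measure set _ -> \bar R}) N in
  (0 <= \int[mu]_z logabs (toC z - toC (a, 0%R))%R)%E ->
  (0 <= \int[mu]_z logabs (toC z - toC (b, 0%R))%R)%E ->
  forall p : {poly R[i]}, (0 <= logabs (lead_coef p))%E ->
  (0 <= \int[mu]_z logabs p.[toC z]%R)%E.
Proof.
move=> mu ha hb p lp.
pose K := segment a b; have mK : measurable K := measurable_segment a b.
have h0 : `|0 : R| < 1 by rewrite normr0.
pose half := (b - a) / 2.
pose g (u y : R) := ln half - ln 2 + ln (1 - 2 * u * y + u ^+ 2).
have muK : mu (~` K) = 0%E.
  have -> : mu (~` K) = (t%:num%:E * nu (~` K) +
      c%:num%:E * \sum_(k < N) om k (~` K))%E by exact: measure_addE.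
  rewrite [X in (_ * X + _)%E]nuK mule0 add0e big1 ?mule0// => k _.
  exact: omK.
have pot x : K x ->
    mu.-integrable setT (fun z => logabs (toC z - toC x)) /\
    (\int[mu]_z logabs (toC z - toC x)%R =
     (t%:num * g 0 (ncoord a b x) +
      c%:num * \sum_(k < N) g (s k) (ncoord a b x))%:E)%E.
  move=> Kx; have [i0 e0] := log_potential ab nuK h0 nu0 Kx.
  have mf := measurable_logabs_sub (toC x).
  have iom k : (k < N)%N ->
      (om k).-integrable setT (fun z => logabs (toC z - toC x)).
    by move=> kN; have [] := log_potential ab (omK _ kN) (s1 _ kN) (oms _ kN) Kx.
  pose omm k : {measure set (plane R) -> \bar R} := om k.
  split; first exact: (@integrable_combination _ _ _ t c nu omm N _ mf i0 iom).
  rewrite (@integral_combination _ _ _ t c nu omm N _ mf i0 iom) e0/=.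
  congr (_ + _ * _)%:E; apply: eq_bigr => k _.
  by have [_ ->] := log_potential ab (omK _ (ltn_ord k)) (s1 _ (ltn_ord k))
    (oms _ (ltn_ord k)) Kx.
have Ka : K (a, 0) by split; rewrite //= lexx ltW.
have Kb : K (b, 0) by split; rewrite //= lexx ltW.
have [_ ea] := pot _ Ka; have [_ eb] := pot _ Kb.
have xa : ncoord a b (a, 0) = -1.
  by rewrite /ncoord /=; field; rewrite subr_eq0 gt_eqF.
have xb : ncoord a b (b, 0) = 1.
  by rewrite /ncoord /=; field; rewrite subr_eq0 gt_eqF.
rewrite ea xa lee_fin in ha; rewrite eb xb lee_fin in hb.
have pos x : K x -> (0 <= \int[mu]_z logabs (toC z - toC x)%R)%E.
  move=> Kx; have [_ ->] := pot _ Kx; rewrite lee_fin.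
  have X1 := ncoord_in ab Kx; set X := ncoord a b x in X1 *.
  have gX u : `|u| < 1 -> (1 - X) / 2 * g u (-1) + (1 + X) / 2 * g u 1 <= g u X.
    move=> u1; have := ln_affine_concave u1 X1; rewrite /g.
    by set A := ln (1 - 2 * u * -1 + _); set B := ln (1 - 2 * u * 1 + _); nra.
  have sg : (1 - X) / 2 * (\sum_(k < N) g (s k) (-1)) +
            (1 + X) / 2 * (\sum_(k < N) g (s k) 1) <= \sum_(k < N) g (s k) X.
    rewrite !mulr_sumr -big_split; apply: ler_sum => k _.
    by apply: gX; exact: s1.
  have g0 := gX _ h0; move: X1 => /andP[X0 X1].
  move: sg ha hb g0; set S1 := \sum_(k < N) g _ (-1).
  set S2 := \sum_(k < N) g _ 1; set S3 := \sum_(k < N) g _ X.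
  move=> sg ha hb g0.
  have t0 : 0 <= t%:num by []. have c0 : 0 <= c%:num by [].
  have ht := ler_wpM2l t0 g0; have hc := ler_wpM2l c0 sg.
  apply: le_trans (lerD ht hc).
  have l0 : 0 <= (1 - X) / 2 by lra.
  have l1 : 0 <= (1 + X) / 2 by lra.
  apply: le_trans (addr_ge0 (mulr_ge0 l0 ha) (mulr_ge0 l1 hb)) _.
  by rewrite le_eqVlt; apply/orP; left; apply/eqP; ring.
(* Each root is replaced by its projection, which lowers the integrand on [K]. *)
have [roots pE] := logabs_poly p.
pose G z := (\sum_(r <- roots) logabs (toC z - toC (segment_proj a b r))%R)%E.
have Kp r : K (segment_proj a b r) by apply: segment_proj_in; exact: ltW.
have mlog (x : R[i]) : measurable_fun setT (fun z : plane R => logabs (toC z - x)).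
  exact: measurable_logabs_sub.
have mG : measurable_fun setT G.
  by apply: emeasurable_sum => r; exact: mlog.
have mp : measurable_fun setT (fun z : plane R => logabs p.[toC z]).
  under eq_fun do rewrite pE.
  apply: emeasurable_funD; first exact: measurable_cst.
  by apply: emeasurable_sum => r; exact: mlog.
apply: le_trans (le_integral_concentrated mK muK mG mp _).
  rewrite /G integral_sum//; last by move=> r; have [] := pot _ (Kp r).
  by apply: sume_ge0 => r _; exact: pos.
move=> z Kz; rewrite pE -[G z]add0e; apply: leeD => //.
by apply: lee_sum => r _; apply: logabs_proj_le => //; exact: ltW.
Qed.

Unset Implicit Arguments.

Theorem theoremC (R : realType) (a b : int) (hab : a < b)
    (alpha : R[i]) (halpha : algebraic alpha)
    (hconj : forall gamma, gamma \in conjugates alpha ->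
       complex.Im gamma = 0 /\ ~ (a%:~R <= complex.Re gamma <= b%:~R))
    (t : {i01 R})
    (nu : probability (plane R) R)
    (hnu : is_equilibrium_measure (segment a%:~R b%:~R) nu)
    (omega : R[i] -> probability (plane R) R)
    (homega : forall gamma, gamma \in conjugates alpha ->
       is_harmonic_measure_compact (ofC gamma) (segment a%:~R b%:~R)
         (omega gamma)) :
  (forall Q : {poly int}, Q != 0 ->
     (0 <= \int[mu_t t alpha nu omega]_z
             logabs (map_poly intr Q).[toC z]%R)%E)
  <->
  (0 <= \int[mu_t t alpha nu omega]_z logabs (toC z - a%:~R)%R)%E /\
  (0 <= \int[mu_t t alpha nu omega]_z logabs (toC z - b%:~R)%R)%E.
Proof.
have linear (m : int) :
    (forall Q : {poly int}, Q != 0 ->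
       (0 <= \int[mu_t t alpha nu omega]_z logabs (map_poly intr Q).[toC z]%R)%E) ->
    (0 <= \int[mu_t t alpha nu omega]_z logabs (toC z - m%:~R)%R)%E.
  move=> h; have := h ('X - m%:P) (negbT (polyXsubC_eq0 m)).
  rewrite (eq_integral (fun z => logabs (toC z - m%:~R)%R))//.
  move=> z _; congr logabs.
  by rewrite rmorphB/= map_polyX map_polyC/= hornerXsubC.
split=> [h|[ha hb] Q Q0]; first by split; exact: linear.
have ab : a%:~R < b%:~R :> R by rewrite ltr_int.
have toCm (m : int) : m%:~R = toC (m%:~R, 0) :> R[i].
  by rewrite -(rmorph_int (real_complex R)).
rewrite toCm in ha; rewrite toCm in hb.
pose K : set (plane R) := segment a%:~R b%:~R.
have hs gamma : exists s : R, gamma \in conjugates alpha ->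
    [/\ supported K (omega gamma), `|s| < 1 &
        chebyshev_moments (omega gamma) K (ncoord a%:~R b%:~R) s].
  have [gc|ngc] := boolP (gamma \in conjugates alpha); last by exists 0.
  have [i0 nr] := hconj _ gc.
  have nK : ~ K (ofC gamma) by move=> [h _]; exact: nr.
  have [s hs] := harmonic_measure_real_moments ab nK i0 (homega _ gc).
  by exists s.
have [s sP] := choice hs.
have cj k : (k < size (conjugates alpha))%N ->
   (conjugates alpha)`_k \in conjugates alpha by exact: mem_nth.
apply: (@potential_criterion R a%:~R b%:~R ab _ _ nu
  (fun k => omega (conjugates alpha)`_k) (size (conjugates alpha))
  (fun k => s (conjugates alpha)`_k)) => //.
- exact: hnu.1.
- exact: (equilibrium_moments ab hnu.1 hnu).
- by move=> k /cj/sP[].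
- by move=> k /cj/sP[].
- by move=> k /cj/sP[].
- rewrite lead_coef_map_inj//; last exact: intr_inj.
  by apply: logabs_int_ge0; rewrite lead_coef_eq0.
Qed.
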